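(* Let $E\subset\mathbb{R}^2$ be a rectifiable set with tangent field $x\mapsto\theta_x$, and let $\Gamma\subset\mathbb{R}^2$ be a rectifiable curve. Suppose that for every direction $\theta \in \mathbb{P}^1$, the set $\{x \in E : \theta_x = \theta\}$ is $\mathcal{H}^1$-null. Then there exist a subset $E_0\subset E$ of full $\mathcal{H}^1$-measure in $E$, a path $P\subset\mathbb{R}^2$, and directions $\theta_p\in\mathbb{P}^1$ ($p\in P$) such that, with $E^p=\{x\in E_0:\theta_x\neq\theta_p\}$, the set $$A:=\bigcup_{q \in \mathbb{Q}^2}\ \bigcup_{p \in P} \big(q + p+E^p\big)$$ satisfies: (1) $A$ has Lebesgue measure zero; (2) through each point $y \in \mathbb{R}^2$, $A$ contains a translated copy of $\mathcal{H}^1$-a.e. point of $E$; that is, for all $y \in \mathbb{R}^2$ there are $E_y \subset E$ and $p_y \in \mathbb{R}^2$ such that $\mathcal{H}^1(E \setminus E_y) = 0$, $y \in p_y + \Gamma$, and $p_y + E_y \subset A$.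
   Context: $\mathcal{H}^1$ is 1-dimensional Hausdorff measure. $\mathbb{P}^1\simeq\mathbb{R}/\pi\mathbb{Z}$ is the set of directions in $\mathbb{R}^2$. $E_0\subset E$ has full $\mathcal{H}^1$-measure in $E$ if $\mathcal{H}^1(E\setminus E_0)=0$. A path is the image of a continuous map on a compact interval. $E$ is rectifiable if $\mathcal{H}^1$-a.e. point of $E$ can be covered by countably many $C^1$ curves. A tangent field of $E$ is a map $x\mapsto\theta_x$ from $E$ to $\mathbb{P}^1$ such that for any $C^1$ curve $G$, the tangent direction of $G$ at $x$ equals $\theta_x$ for $\mathcal{H}^1$-a.e. $x\in G\cap E$. A rectifiable curve is a continuous curve of finite length in $\mathbb{R}^2$ that is non-degenerate (not a single point). *)

(* Defs.v *)
From HB Require Import structures.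
From mathcomp Require Import all_boot all_order all_algebra.
From mathcomp Require Import generic_quotient.
From mathcomp Require Import all_classical all_reals all_analysis.

Set Implicit Arguments.
Unset Strict Implicit.
Unset Printing Implicit Defensive.

Import Order.TTheory GRing.Theory Num.Theory.
Import numFieldNormedType.Exports.

Local Open Scope classical_set_scope.
Local Open Scope ring_scope.

(* The plane is [R * R]. Its library norm is the sup norm, so the Euclidean
   norm is introduced separately; it is the one used for lengths and for
   Hausdorff measure. *)
Definition enorm (R : realType) (v : R * R) : R :=
  Num.sqrt (v.1 ^+ 2 + v.2 ^+ 2).

(* The value 0 is added because the supremum of the empty set is -oo,
   while diam set0 = 0. *)
Definition diam (R : realType) (U : set (R * R)) : \bar R :=
  ereal_sup ([set 0%E] `|`
    [set (enorm (xy.1 - xy.2))%:E | xy in U `*` U]).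

Definition hausdorff1_pre (R : realType) (delta : R) (S : set (R * R)) :
    \bar R :=
  ereal_inf [set (\sum_(0 <= i <oo) diam (U i))%E |
    U in [set U : nat -> set (R * R) |
            S `<=` \bigcup_i U i /\ forall i, (diam (U i) <= delta%:E)%E]].

Definition hausdorff1 (R : realType) (S : set (R * R)) : \bar R :=
  ereal_sup [set hausdorff1_pre delta S | delta in [set d : R | 0 < d]].

Definition H1_null (R : realType) (S : set (R * R)) : Prop :=
  hausdorff1 S = 0%E.

Definition full_H1 (R : realType) (E0 E : set (R * R)) : Prop :=
  E0 `<=` E /\ H1_null (E `\` E0).

Definition eqmodpi (R : realType) : rel R :=
  fun a b => `[< exists k : int, a - b = k%:~R * pi >].

Lemma eqmodpi_refl (R : realType) : reflexive (@eqmodpi R).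
Proof. by move=> a; apply/asboolP; exists 0; rewrite subrr mul0r. Qed.

Lemma eqmodpi_sym (R : realType) : symmetric (@eqmodpi R).
Proof.
have H (a b : R) : eqmodpi a b -> eqmodpi b a.
  move=> /asboolP[k abk]; apply/asboolP; exists (- k).
  by rewrite mulrNz mulNr -abk opprB.
by move=> a b; apply/idP/idP; apply: H.
Qed.

Lemma eqmodpi_trans (R : realType) : transitive (@eqmodpi R).
Proof.
move=> b a c /asboolP[k abk] /asboolP[l bcl]; apply/asboolP.
by exists (k + l); rewrite mulrzDr mulrDl -abk -bcl addrA subrK.
Qed.

Definition eqmodpi_equiv (R : realType) : equiv_rel R :=
  EquivRel (@eqmodpi R) (@eqmodpi_refl R) (@eqmodpi_sym R) (@eqmodpi_trans R).

(* P^1 = R / pi Z. *)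
Definition P1 (R : realType) := {eq_quot (eqmodpi_equiv R)}%qT.

Definition dir (R : realType) (a : R) : P1 R := (\pi_(P1 R) a)%qT.

Definition has_direction (R : realType) (v : R * R) (d : P1 R) : Prop :=
  exists a r : R, [/\ r != 0, v = (r * cos a, r * sin a) & d = dir a].

Definition is_path (R : realType) (P : set (R * R)) : Prop :=
  exists (a b : R) (g : R -> R * R),
    [/\ a <= b, {within `[a, b], continuous g} & P = g @` `[a, b]].

(* Length of the parametrized curve g on [a, b] (in [0, +oo]). *)
Definition path_length (R : realType) (a b : R) (g : R -> R * R) : \bar R :=
  ereal_sup [set (let G := g \o nth b (a :: s) in
                  \sum_(0 <= n < size s) enorm (G n.+1 - G n))%:E |
    s in itv_partition a b].

Definition rectifiable_curve (R : realType) (Gamma : set (R * R)) : Prop :=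
  (exists (a b : R) (g : R -> R * R),
    [/\ a <= b, {within `[a, b], continuous g}, (path_length a b g < +oo)%E
      & Gamma = g @` `[a, b]]) /\
  exists x y : R * R, [/\ Gamma x, Gamma y & x <> y].

(* g is a regular C^1 parametrization on [a, b], with derivative dg. The
   difference quotients are restricted to [a, b], so the derivatives at the
   end points are one-sided. *)
Definition C1_param (R : realType) (a b : R) (g dg : R -> R * R) : Prop :=
  [/\ a < b,
      forall t, `[a, b]%classic t ->
        (fun s => (s - t)^-1 *: (g s - g t))
          @ within `[a, b] (t^') --> dg t,
      {within `[a, b], continuous dg}
    & forall t, `[a, b]%classic t -> dg t != 0].

Definition C1_curve (R : realType) (G : set (R * R)) : Prop :=
  exists (a b : R) (g dg : R -> R * R),
    C1_param a b g dg /\ G = g @` `[a, b].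

Definition rectifiable (R : realType) (E : set (R * R)) : Prop :=
  exists G : nat -> set (R * R),
    (forall i, C1_curve (G i)) /\ H1_null (E `\` \bigcup_i G i).

(* The curves are not assumed injective: d is a tangent direction at x as soon
   as it is that of some branch of the curve through x. *)
Definition tangent_direction (R : realType) (a b : R) (g dg : R -> R * R)
    (x : R * R) (d : P1 R) : Prop :=
  exists2 t, `[a, b]%classic t & g t = x /\ has_direction (dg t) d.

(* Only the values of theta on E matter. Since g is regular, tangent
   directions exist at every point of the curve, so the universal quantifier
   over d is not vacuous. *)
Definition tangent_field (R : realType) (E : set (R * R))
    (theta : R * R -> P1 R) : Prop :=
  forall (a b : R) (g dg : R -> R * R), C1_param a b g dg ->
    H1_null [set x | (g @` `[a, b] `&` E) x /\
      ~ (forall d, tangent_direction a b g dg x d -> d = theta x)].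

Definition ratvec (R : realType) (q : rat * rat) : R * R :=
  (ratr q.1, ratr q.2).

Definition lebesgue_null2 (R : realType) (A : set (R * R)) : Prop :=
  (@lebesgue_measure R \x @lebesgue_measure R)%E.-negligible A.

(* Main.v *)
Require Import Defs.
From HB Require Import structures.
From mathcomp Require Import all_boot all_order all_algebra.
From mathcomp Require Import generic_quotient.
From mathcomp Require Import all_classical all_reals all_analysis.
From mathcomp Require Import ring lra.

Set Implicit Arguments.
Unset Strict Implicit.
Unset Printing Implicit Defensive.

Import Order.TTheory GRing.Theory Num.Theory.
Import numFieldNormedType.Exports.

Local Open Scope classical_set_scope.
Local Open Scope ring_scope.

(** Why the theorem is true.

A translation in direction v moves a short arc with tangent direction v' over
an area of order |sin (v - v')|, so nearly parallel arcs cost almost nothing.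
The path P is obtained from a straight segment by replacing each segment, again
and again, by a fine zigzag in two other directions, in the manner of a
Venetian blind. While a branch of this process rotates, it meets one direction
after another; when it first travels along a direction, the arcs of E with
nearly that tangent are swept over a small area, and they remain harmless,
because all later refinements stay in a tiny neighbourhood of the segment. Such
a direction is called killed. Once a branch has killed all directions but a
short interval, it stops, and a direction next to that interval becomes the tag
of the final small segment: at the points of the path on this segment, only the
arcs of E with tangent close to the tag can sweep a large area; in the limit,
the points of E on such arcs are the ones that are discarded.

The quantitative heart is [tp_blinds]. A branch that has killed the angles
[c, d] and travels along d is split into the directions d + h and c - h (and
likewise from c). The law of sines makes the total length grow at each
step by the factor cos (w / 2) / cos (w / 2 + h), with w = d - c. These factors
telescope, so the total length stays bounded by a constant depending only on
eta as long as w <= pi - eta, however small the step h is. Each arc is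
swept once per branch, at a cost of order h times the length of the branch
([cov_sweep]); hence the total area is O(h).

Since the zigzags may be as fine as desired, any continuous path can be
followed ([tp_follow]); cutting finitely many C^1 curves into nearly straight
arcs ([curves_arcs]) gives one [stage]. Iterating with areas 2^-k, each path
being so close to the preceding one that all earlier coverings survive, gives a
uniform limit P ([limit_path]). The direction attached to p is a cluster
point of the tags of p: a point of E whose tangent differs from it is far from
the tags for infinitely many stages, so its translate lies in the upper limit of
the coverings, which is a null set by Borel-Cantelli ([null_limsup]).

Only the points of E on the C^1 curves and with matching tangents are kept in
E_0. The points thrown out, and for each p the points with tangent direction
theta_p, form null sets. Finally, P is close to a long segment transversal to a
chord of Gamma, so that for each z in some disc, z - P and Gamma cross each
other like two paths joining opposite sides of a rectangle ([paths_cross], from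
Sperner's lemma); the rational translations then bring every point of the plane
into P + Gamma. *)

(** * Directions and cross products *)

Lemma pair_ext (S T : Type) (v w : S * T) : v.1 = w.1 -> v.2 = w.2 -> v = w.
Proof. by case: v w => [? ?] [? ?] /= -> ->. Qed.

Ltac vec_ring := apply: pair_ext; rewrite /= /GRing.scale /=; ring.

Section Trig.
Context {R : realType}.
Implicit Types (a b x y : R) (v w : R * R).

Definition udir a : R * R := (cos a, sin a).

Definition cross v w : R := v.1 * w.2 - v.2 * w.1.

Lemma norm_pairE v : `|v| = Num.max `|v.1| `|v.2|.
Proof. by case: v. Qed.

Lemma norm_fst_le v : `|v.1| <= `|v|.
Proof. by rewrite norm_pairE le_max lexx. Qed.

Lemma norm_snd_le v : `|v.2| <= `|v|.
Proof. by rewrite norm_pairE le_max lexx orbT. Qed.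

Lemma norm_pair_le v c : `|v.1| <= c -> `|v.2| <= c -> `|v| <= c.
Proof. by rewrite norm_pairE ge_max => -> ->. Qed.

Lemma norm_udir a : `|udir a| <= 1.
Proof. by apply: norm_pair_le; [exact: cos_max|exact: sin_max]. Qed.

Lemma norm_Zudir l a : `|l *: udir a| <= `|l|.
Proof. by rewrite normrZ ler_piMr// norm_udir. Qed.

Lemma sinD_norm_le x y : `|sin (x + y)| <= `|sin x| + `|sin y|.
Proof.
rewrite sinD (le_trans (ler_normD _ _))// !normrM lerD//.
  by rewrite ler_piMr// cos_max.
by rewrite ler_piMl// cos_max.
Qed.

Lemma sin_norm_le x : `|sin x| <= `|x|.
Proof.
wlog x0 : x / 0 <= x.
  move=> H; have [/H//|/ltW x0] := leP 0 x.
  by rewrite -(normrN (sin x)) -sinN -(normrN x); apply: H; rewrite oppr_ge0.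
have [c _] := @MVT_segment R sin cos 0 x x0
  (fun y _ => is_derive_sin y) (continuous_subspaceT (@continuous_sin R)).
rewrite sin0 !subr0 => ->.
by rewrite normrM ler_piMl// cos_max.
Qed.

Lemma sinD_intpi x (k : int) : `|sin (x + k%:~R * pi)| = `|sin x|.
Proof.
have H (n : nat) y : `|sin (y + n%:R * pi)| = `|sin y|.
  elim: n y => [|n IH] y; first by rewrite mul0r addr0.
  by rewrite mulrSr mulrDl mul1r addrA sinDpi normrN IH.
case: k => n; first exact: H.
by rewrite NegzE -[RHS](H n.+1) -(H n.+1 (x + _)) mulrNz mulNr subrK.
Qed.

Lemma modpi_ex x : exists k : int, 0 <= x + k%:~R * pi < pi.
Proof.
exists (- Num.floor (x / pi)).
have := floor_itv (x / pi); rewrite intrD1.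
rewrite ler_pdivlMr ?pi_gt0// ltr_pdivrMr ?pi_gt0// => /andP[h1 h2].
by rewrite mulrNz; apply/andP; split; nra.
Qed.

Lemma sin_eq0_intpi x : sin x = 0 -> exists k : int, x = k%:~R * pi.
Proof.
move=> sx; have [k /andP[k0 kpi]] := modpi_ex x.
have : sin (x + k%:~R * pi) = 0 by apply/normr0_eq0; rewrite sinD_intpi sx normr0.
move: k0; rewrite le_eqVlt => /predU1P[e _|k0 s0].
  by exists (- k); rewrite mulrNz mulNr; apply/eqP; rewrite -addr_eq0 -e.
by have := @sin_gt0_pi R _ (introT andP (conj k0 kpi)); rewrite s0 ltxx.
Qed.

Lemma polar_ex v : v != 0 -> exists a r, r != 0 /\ v = r *: udir a.
Proof.
case: v => x y v0; set r := Num.sqrt (x ^+ 2 + y ^+ 2).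
have s0 : 0 <= x ^+ 2 + y ^+ 2 by rewrite addr_ge0 ?sqr_ge0.
have r2 : r ^+ 2 = x ^+ 2 + y ^+ 2 by rewrite sqr_sqrtr.
have r0 : r != 0.
  apply: contra_neq v0 => r0; move/eqP: r2; rewrite r0 expr0n/= eq_sym.
  by rewrite paddr_eq0 ?sqr_ge0// !sqrf_eq0 => /andP[/eqP-> /eqP->].
have c2 : (x / r) ^+ 2 + (y / r) ^+ 2 = 1.
  by rewrite !expr_div_n -mulrDl -r2 divff// sqrf_eq0.
have cI : -1 <= x / r <= 1.
  rewrite -ler_norml -(@expr_le1 _ 2)// real_normK ?num_real//.
  by rewrite -c2 lerDl sqr_ge0.
have sE : Num.sqrt (1 - (x / r) ^+ 2) = `|y / r|.
  by rewrite -c2 addrC addrA addNr add0r sqrtr_sqr.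
pose a := acos (x / r).
have [y0|y0] := leP 0 (y / r).
  exists a, r; split=> //; rewrite /udir /a acosK ?in_itv//= sin_acos// sE.
  by rewrite ger0_norm//; congr pair; rewrite /= /GRing.scale/= mulrC divfK.
exists (- a), r; split=> //; rewrite /udir /a cosN sinN acosK ?in_itv//=.
rewrite sin_acos// sE ltr0_norm// opprK.
by congr pair; rewrite /= /GRing.scale/= mulrC divfK.
Qed.

Lemma crossBl v w z : cross (v - w) z = cross v z - cross w z.
Proof. by rewrite /cross/=; ring. Qed.

Lemma crossZl r v w : cross (r *: v) w = r * cross v w.
Proof. by rewrite /cross/= /GRing.scale/=; ring. Qed.

Lemma cross_udir a b : cross (udir a) (udir b) = sin (b - a).
Proof. by rewrite /cross/= sinB; ring. Qed.

Lemma cross_le v a : `|cross v (udir a)| <= 2 * `|v|.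
Proof.
rewrite /cross/= (le_trans (ler_normB _ _))// !normrM mulr2n mulrDl !mul1r.
apply: lerD.
- by rewrite (le_trans _ (norm_fst_le v))// ler_piMr// sin_max.
- by rewrite (le_trans _ (norm_snd_le v))// ler_piMr// cos_max.
Qed.

Definition dot v w : R := v.1 * w.1 + v.2 * w.2.

Lemma dot_le v a : `|dot v (udir a)| <= 2 * `|v|.
Proof.
rewrite /dot/= (le_trans (ler_normD _ _))// !normrM mulr2n mulrDl !mul1r.
apply: lerD.
- by rewrite (le_trans _ (norm_fst_le v))// ler_piMr// cos_max.
- by rewrite (le_trans _ (norm_snd_le v))// ler_piMr// sin_max.
Qed.

Lemma frame_decomp v a : v = dot v (udir a) *: udir a - cross v (udir a) *: udir (a + pi / 2).
Proof.
case: v => x y; rewrite /udir cosDpihalf sinDpihalf.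
by congr pair; rewrite -[LHS]mulr1 -(cos2Dsin2 a) /= /GRing.scale/= /dot /cross/=;
  ring.
Qed.

Lemma cross_rot v a b :
  `|cross v (udir b)| <= `|cross v (udir a)| + 2 * `|v| * `|sin (b - a)|.
Proof.
have -> : cross v (udir b) =
    cross v (udir a) * cos (b - a) + dot v (udir a) * sin (b - a).
  rewrite -{1}(subrK a b) /cross/= (sinD (b - a)) (cosD (b - a)) /dot/=; ring.
rewrite (le_trans (ler_normD _ _))// !normrM lerD//.
- by rewrite ler_piMr// cos_max.
- by rewrite ler_wpM2r// dot_le.
Qed.

End Trig.

(** * Coverings by finitely many squares *)

Section Cover.
Context {R : realType}.
Implicit Types (U V : set (R * R)) (e d : R).

(** A ball of the sup norm is a square: up to a factor 4 the sum is the total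
area of the squares. Coverings by finitely many squares, unlike bounds for the
outer measure, survive a small enlargement of the set ([cov_fat]). *)
Definition covered_area U e := exists s : seq ((R * R) * R),
  [/\ forall z, U z -> exists2 c, c \in s & `|z - c.1| <= c.2,
      forall c, c \in s -> 0 <= c.2
    & \sum_(c <- s) c.2 ^+ 2 <= e].

Lemma cov0 : covered_area set0 0.
Proof. by exists [::]; split=> //; rewrite big_nil. Qed.

Lemma cov_sub U V e e' : U `<=` V -> e <= e' -> covered_area V e -> covered_area U e'.
Proof.
move=> UV ee' [s [sV s0 se]]; exists s; split=> // [z /UV/sV//|].
exact: le_trans ee'.
Qed.

Lemma covU U V e e' : covered_area U e -> covered_area V e' -> covered_area (U `|` V) (e + e').
Proof.
move=> [s [sU s0 se]] [s' [sU' s0' se']]; exists (s ++ s'); split.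
- move=> z [/sU|/sU'] [c cs cz]; exists c => //; rewrite mem_cat cs ?orbT//.
- by move=> c; rewrite mem_cat => /orP[/s0|/s0'].
- by rewrite big_cat lerD.
Qed.

Lemma cov_bigU (n : nat) (U : nat -> set (R * R)) (e : nat -> R) :
  (forall k, (k < n)%N -> covered_area (U k) (e k)) ->
  covered_area [set z | exists2 k, (k < n)%N & U k z] (\sum_(k < n) e k).
Proof.
elim: n => [|n IH] H.
  by rewrite big_ord0; apply: cov_sub cov0 => // z [].
rewrite big_ord_recr/=; apply: cov_sub (covU (IH _) (H n _)) => //.
- move=> z [k]; rewrite ltnS leq_eqVlt => /predU1P[->|kn] Uz; first by right.
  by left; exists k.
- by move=> k kn; apply: H; rewrite ltnS ltnW.
Qed.

Lemma cov_translate U e v : covered_area U e -> covered_area [set z | U (z - v)] e.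
Proof.
move=> [s [sU s0 se]]; exists [seq (c.1 + v, c.2) | c <- s]; split.
- move=> z /sU[c cs cz]; exists (c.1 + v, c.2) => /=; first exact: (map_f (fun c => (c.1 + v, c.2))).
  by rewrite (_ : z - _ = z - v - c.1)//; vec_ring.
- by move=> _ /mapP[c cs ->] /=; exact: s0.
- by rewrite big_map.
Qed.

(** This is what makes a covering of the translates along one path valid for all
sufficiently close paths. *)
Lemma cov_fat U e e' : covered_area U e -> e < e' ->
  exists2 d, 0 < d & covered_area [set z | exists2 y, U y & `|z - y| <= d] e'.
Proof.
move=> [s [sU s0 se]] ee'.
(* For d <= 1 the growth of the sum of the (c.2 + d)^2 is at most d * K. *)
pose K := \sum_(c <- s) (2 * c.2 + 1).
have K0 : 0 <= K.
  rewrite /K big_seq sumr_ge0// => c /s0 c0.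
  by rewrite addr_ge0// mulr_ge0.
pose d := Num.min 1 ((e' - e) / (K + 1)).
have d0 : 0 < d.
  by rewrite lt_min ltr01/= divr_gt0// ?subr_gt0// ltr_wpDl.
have d1 : d <= 1 by rewrite /d ge_min lexx.
have dK : d * (K + 1) <= e' - e.
  by rewrite -ler_pdivlMr ?ltr_wpDl// /d ge_min lexx orbT.
exists d => //; exists [seq (c.1, c.2 + d) | c <- s]; split.
- move=> z [y /sU[c cs cy] zy]; exists (c.1, c.2 + d).
    exact: (map_f (fun c => (c.1, c.2 + d))).
  by rewrite -(subrKA y) (le_trans (ler_normD _ _))//= addrC lerD.
- by move=> _ /mapP[c cs ->]; rewrite addr_ge0 ?s0// ltW.
- rewrite big_map/= (@le_trans _ _ (\sum_(c <- s) (c.2 ^+ 2 + d * (2 * c.2 + 1))))//.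
    apply: ler_sum => c _.
    have : d * d <= d * 1 by exact: ler_wpM2l (ltW d0) _ _ d1.
    by rewrite sqrrD; lra.
  rewrite big_split/= -mulr_sumr -/K.
  by move: se d0 dK; rewrite mulrDr; lra.
Qed.

(** A strip of length 2X and width 2 sig needs about X / sig squares of side
4 sig. *)
Lemma cov_strip (c u : R * R) (X sig : R) : `|u| <= 1 -> 0 < sig -> sig <= X ->
  covered_area [set z | exists2 x : R, `|x| <= X & `|z - c - x *: u| <= sig] (20 * X * sig).
Proof.
move=> u1 sig0 sX.
have X0 : 0 < X := lt_le_trans sig0 sX.
pose m := (Num.truncn (X / sig)).+1.
have Xm : X <= m%:R * sig.
  rewrite -ler_pdivrMr// ltW// truncnS_gt//.
have mX : m%:R * sig <= X + sig.
  rewrite -ler_pdivlMr// mulrDl divff ?gt_eqF// /m mulrSr lerD2r.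
  by rewrite truncn_le// divr_ge0// ltW.
pose f (k : nat) := (c + ((k%:R - m%:R) * sig) *: u, 2 * sig).
exists [seq f k | k <- iota 0 m.*2.+1]; split.
- move=> z [x xX zx].
  pose k := Num.truncn ((x + m%:R * sig) / sig).
  have y0 : 0 <= x + m%:R * sig.
    by move: xX Xm; rewrite ler_norml => /andP[]; lra.
  have /andP[k1 k2] := truncn_itv (divr_ge0 y0 (ltW sig0)).
  have xu : x + m%:R * sig <= (m.*2)%:R * sig.
    rewrite -addnn natrD; move: xX Xm; rewrite ler_norml => /andP[]; lra.
  exists (f k).
    apply: map_f; rewrite mem_iota add0n/= ltnS -(ler_nat R).
    apply: le_trans k1 _; by rewrite ler_pdivrMr.
  have {}k1 : k%:R * sig <= x + m%:R * sig by rewrite -ler_pdivlMr.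
  have {}k2 : x + m%:R * sig < k%:R * sig + sig.
    by move: k2; rewrite ltr_pdivrMr// -/k -natr1; lra.
  rewrite /f/=.
  have -> : z - (c + ((k%:R - m%:R) * sig) *: u) =
            (z - c - x *: u) + (x - (k%:R - m%:R) * sig) *: u.
    by rewrite scalerBl opprD !addrA subrK.
  have : `|(x - (k%:R - m%:R) * sig) *: u| <= sig.
    rewrite normrZ -[leRHS]mulr1 ler_pM// ler_norml.
    by apply/andP; split; lra.
  by move=> ?; apply: (le_trans (ler_normD _ _)); lra.
- by move=> _ /mapP[k _ ->]; rewrite /f/= mulr_ge0// ltW.
- rewrite big_map (eq_bigr (fun=> (2 * sig) ^+ 2))//.
  rewrite -[m.*2.+1]subn0 -/(index_iota 0 _) sumr_const_nat subn0.
  rewrite -mulr_natl -addnn -addn1 !natrD.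
  have : (m%:R * sig) * sig <= (X + sig) * sig by rewrite ler_wpM2r// ltW.
  have : sig * sig <= X * sig by rewrite ler_wpM2r// ltW.
  by rewrite exprMn; lra.
Qed.

(** A curve whose tangent stays within kap of the direction a, translated along a
segment of this direction, sweeps an area of order kap times both lengths.
Cutting the curve into pieces no longer than the segment makes the sweep of each
piece a thin strip along the segment. *)
Lemma cov_sweep (gam : R -> R * R) (al be B kap a l : R) :
  al < be -> 0 < B -> 0 < kap -> kap <= 1 -> l != 0 ->
  (forall s t, al <= s <= be -> al <= t <= be ->
    `|gam s - gam t| <= B * `|s - t|) ->
  (forall s t, al <= s <= be -> al <= t <= be ->
    `|cross (gam s - gam t) (udir a)| <= kap * B * `|s - t|) ->
  exists2 d, 0 < d &
    covered_area [set z | exists t r : R, [/\ al <= t <= be, 0 <= r <= 1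
                   & `|z - (gam t + r *: (l *: udir a))| <= d]]
        (240 * kap * (B * (be - al)) * `|l|).
Proof.
move=> albe B0 kap0 kap1 l0 gamL gamX.
have nl0 : 0 < `|l| by rewrite normr_gt0.
have ba0 : 0 < be - al by rewrite subr_gt0.
pose n := (Num.truncn (B * (be - al) / `|l|)).+1.
pose rho := (be - al) / n%:R.
have n0 : 0 < n%:R :> R by rewrite ltr0n.
have nrho : n%:R * rho = be - al by rewrite /rho mulrC divfK// gt_eqF.
have rho0 : 0 < rho by rewrite divr_gt0.
have Brho : B * rho <= `|l|.
  rewrite /rho mulrA ler_pdivrMr// (mulrC `|l|) -ler_pdivrMr//.
  by rewrite ltW// truncnS_gt.
pose d := kap * B * rho.
have d0 : 0 < d := mulr_gt0 (mulr_gt0 kap0 B0) rho0.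
exists d => //.
pose t_ (j : nat) := al + j%:R * rho.
have dl : 2 * d <= 3 * `|l|.
  have : kap * (B * rho) <= 1 * `|l| by rewrite ler_pM// ?ltW// mulr_gt0.
  by rewrite /d mulrA; lra.
have d20 : 0 < 2 * d by rewrite mulr_gt0.
have := @cov_bigU n.+1 _ _
  (fun j _ => cov_strip (gam (t_ j)) (norm_udir a) d20 dl).
rewrite sumr_const card_ord -[_ *+ n.+1]mulr_natl; apply: cov_sub; last first.
  have -> : 240 * kap * (B * (be - al)) * `|l| = n%:R * (240 * d * `|l|).
    by rewrite -nrho /d; ring.
  have -> : n.+1%:R * (20 * (3 * `|l|) * (2 * d)) = n.+1%:R * (120 * d * `|l|) :> R.
    by ring.
  have : (n.+1)%:R <= n%:R * 2 :> R.
    by rewrite -natrM ler_nat muln2 -addnn -addn1 leq_add2l.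
  move=> /(ler_wpM2r (_ : 0 <= 120 * d * `|l|)) h; apply: le_trans (h _) _.
    by rewrite !mulr_ge0// ltW.
  by lra.
move=> z [t [r [/andP[t1 t2] /andP[r0 r1] zd]]].
pose j := Num.truncn ((t - al) / rho).
have tal : 0 <= (t - al) / rho by rewrite divr_ge0// ?subr_ge0// ltW.
have /andP[j1 j2] := truncn_itv tal.
exists j.
  rewrite ltnS -(ler_nat R); apply: le_trans j1 _.
  by rewrite ler_pdivrMr// nrho lerD2r.
have {}j1 : j%:R * rho <= t - al by rewrite -ler_pdivlMr.
have {}j2 : t - al < j%:R * rho + rho.
  by move: j2; rewrite ltr_pdivrMr// -/j -natr1; lra.
have jt : al <= t_ j <= be.
  by rewrite /t_; apply/andP; split; [rewrite lerDl mulr_ge0// ltW|lra].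
have tt : `|t - t_ j| <= rho.
  by rewrite /t_ ler_norml; apply/andP; split; lra.
have tI : al <= t <= be by rewrite t1.
pose v := gam t - gam (t_ j).
have vB : `|v| <= B * rho.
  by apply: le_trans (gamL _ _ tI jt) _; rewrite ler_pM2l.
have vX : `|cross v (udir a)| <= d.
  by apply: le_trans (gamX _ _ tI jt) _; rewrite ler_wpM2l// ltW// mulr_gt0.
(* In the frame of direction a, the displacement along the curve and the
   translation add up along a, and only the transversal part d remains. *)
exists (dot v (udir a) + r * l).
  rewrite (le_trans (ler_normD _ _))//.
  have := dot_le v a.
  have : `|r * l| <= `|l| by rewrite normrM ger0_norm// ler_piMl.
  by lra.
have -> : z - gam (t_ j) - (dot v (udir a) + r * l) *: udir a =
   (z - (gam t + r *: (l *: udir a))) - cross v (udir a) *: udir (a + pi / 2).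
  have -> : gam (t_ j) = gam t - v by rewrite /v opprB addrC subrK.
  move: (v) => w; rewrite {1}(frame_decomp w a).
  by vec_ring.
have : `|cross v (udir a) *: udir (a + pi / 2)| <= d.
  exact: le_trans (norm_Zudir _ _) _.
by move=> ?; apply: (le_trans (ler_normB _ _)); lra.
Qed.

End Cover.

(** * Concatenation of paths with tags *)

Section Concatenation.
Context {R : realType}.

Definition clamp01 (x : R) : R := (`|x| - `|x - 1| + 1) / 2.

Lemma clamp01_le0 x : x <= 0 -> clamp01 x = 0.
Proof.
by move=> x0; rewrite /clamp01 ler0_norm// ler0_norm ?subr_le0; [field|lra].
Qed.

Lemma clamp01_ge1 x : 1 <= x -> clamp01 x = 1.
Proof.
by move=> x0; rewrite /clamp01 ger0_norm ?ger0_norm ?subr_ge0//; [field|lra].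
Qed.

Lemma clamp01_id x : 0 <= x <= 1 -> clamp01 x = x.
Proof.
move=> /andP[x0 x1]; rewrite /clamp01 ger0_norm// ler0_norm ?subr_le0//.
by field.
Qed.

Lemma continuous_clamp01 : continuous clamp01.
Proof.
move=> x; apply: cvgM; last exact: cvg_cst.
apply: cvgD; last exact: cvg_cst.
apply: cvgB; first by apply: cvg_norm; exact: cvg_id.
by apply: cvg_norm; apply: cvgB; [exact: cvg_id|exact: cvg_cst].
Qed.

Lemma grid_index (n : nat) (t : R) : (0 < n)%N -> 0 <= t <= n%:R ->
  exists2 j : nat, (j < n)%N & j%:R <= t <= j%:R + 1.
Proof.
move=> n0 /andP[t0 tn]; have [tn'|nt] := ltP t n%:R.
  exists (Num.truncn t); have /andP[h1 h2] := truncn_itv t0.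
    by rewrite -(ltr_nat R); apply: le_lt_trans h1 _.
  by rewrite h1/= natr1 ltW.
exists n.-1; first by rewrite ltn_predL.
rewrite natr1 prednK// tn andbT.
by rewrite (le_trans _ nt)// ler_nat leq_pred.
Qed.

(** The sum of the pieces with clamped parameters is continuous on the whole line, and
on the j-th interval only the j-th piece moves. *)
Lemma path_cat (n : nat) (g_ : nat -> R -> R * R) : (0 < n)%N ->
  (forall j, continuous (g_ j)) -> (forall j, g_ j 0 = 0) ->
  exists g : R -> R * R, [/\ continuous g, g 0 = 0,
    g 1 = \sum_(j < n) g_ j 1
  & forall s : R, 0 <= s <= 1 -> exists j (r : R), [/\ (j < n)%N, 0 <= r <= 1,
      n%:R * s = j%:R + r & g s = \sum_(i < j) g_ i 1 + g_ j r]].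
Proof.
move=> n0 gc g0; exists (fun s => \sum_(j < n) g_ j (clamp01 (n%:R * s - j%:R))).
split.
- apply: continuous_big => [|j _ s]; first exact: add_continuous.
  apply: (@cvg_comp _ _ _ (fun s => clamp01 (n%:R * s - j%:R))); last exact: gc.
  apply: (@cvg_comp _ _ _ (fun s => n%:R * s - j%:R)); last exact: continuous_clamp01.
  by apply: cvgB; [apply: cvgMr; exact: cvg_id|exact: cvg_cst].
- rewrite big1// => j _; rewrite mulr0 clamp01_le0 ?g0//.
- apply: eq_bigr => j _; rewrite mulr1 clamp01_ge1//.
  by rewrite lerBrDr nat1r ler_nat.
- move=> s /andP[s0 s1]; set t := n%:R * s.
  have t0 : 0 <= t by rewrite mulr_ge0.
  have tn : t <= n%:R by rewrite /t ler_piMr.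
  have t0n : 0 <= t <= n%:R by rewrite t0.
  have [j jn /andP[j1 j2]] := grid_index n0 t0n.
  exists j, (t - j%:R); split=> //; first by apply/andP; split; lra.
    by rewrite addrC subrK.
  rewrite -(big_mkord xpredT (fun i => g_ i (clamp01 (t - i%:R)))).
  rewrite (@big_cat_nat _ _ _ j.+1)//= big_nat_recr//=.
  rewrite [X in _ + X]big_nat_cond [X in _ + X]big1 ?addr0; last first.
    move=> i /andP[/andP[ji _] _]; rewrite clamp01_le0 ?g0//.
    have : j%:R + 1 <= i%:R :> R by rewrite natr1 ler_nat.
    by lra.
  rewrite big_mkord clamp01_id; last by apply/andP; split; lra.
  congr (_ + _); apply: eq_bigr => i _; rewrite clamp01_ge1//.
  have : i%:R + 1 <= j%:R :> R by rewrite natr1 ler_nat.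
  by lra.
Qed.

End Concatenation.

Section TaggedPath.
Context {R : realType} (m : nat) (gam : nat -> R -> R * R) (al be an : nat -> R)
  (eta : R).
Implicit Types (K : set nat) (g : R -> R * R) (V : set (R * R)).

(** [phi] is the tag of the point [g s]: only the arcs whose angle [an k] is
within [eta] of the tag, or which belong to [K], may leave [V] when they are
translated by [g s]. *)
Definition tagged K g V := forall s : R, 0 <= s <= 1 -> exists phi, forall k t,
  (k < m)%N -> ~ K k -> al k <= t <= be k -> eta < `|sin (an k - phi)| ->
  V (g s + gam k t).

(** Closeness is measured to the uniform motion along the segment, which makes it
stable under concatenation; [c] is the area of a covering valid for the arcs
outside [K], and all the other arcs are paid for elsewhere. *)
Definition tagged_path K (v : R * R) (d c : R) := exists g V,
  [/\ continuous g, g 0 = 0 & g 1 = v] /\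
  [/\ forall s : R, 0 <= s <= 1 -> `|g s - s *: v| <= d, covered_area V c & tagged K g V].

Lemma tp_weak K v d d' c c' : d <= d' -> c <= c' -> tagged_path K v d c -> tagged_path K v d' c'.
Proof.
move=> dd cc [g [V [gP [gd Vc gV]]]]; exists g, V; split=> //; split=> //.
  by move=> s s01; apply: le_trans dd; exact: gd.
exact: cov_sub cc Vc.
Qed.

Lemma tp_cat K (n : nat) (v : nat -> R * R) (d : R) (c : nat -> R) : (0 < n)%N ->
  (forall j, tagged_path K (v j) d (c j)) ->
  exists g V, [/\ continuous g, g 0 = 0 & g 1 = \sum_(j < n) v j] /\
    [/\ forall s : R, 0 <= s <= 1 -> exists j (r : R), [/\ (j < n)%N, 0 <= r <= 1,
          n%:R * s = j%:R + r & `|g s - (\sum_(i < j) v i + r *: v j)| <= d],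
        covered_area V (\sum_(j < n) c j) & tagged K g V].
Proof.
move=> n0 /choice[g_ /choice[V_ H]].
have gc j : continuous (g_ j) by have [[]] := H j.
have g0 j : g_ j 0 = 0 by have [[]] := H j.
have g1 j : g_ j 1 = v j by have [[]] := H j.
have [g [cg g00 g11 gs]] := path_cat n0 gc g0.
exists g, [set z | exists2 j, (j < n)%N & V_ j (z - \sum_(i < j) v i)].
split; first by split=> //; rewrite g11; apply: eq_bigr => j _.
have sv j : \sum_(i < j) g_ i 1 = \sum_(i < j) v i.
  by apply: eq_bigr => i _.
split.
- move=> s /gs[j [r [jn r01 sE gE]]]; exists j, r; split=> //.
  rewrite gE sv (addrC _ (g_ j r)) addrKA.
  by have [_ [+ _ _]] := H j; exact.
- apply: cov_bigU => j jn; apply: cov_translate.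
  by have [_ [_ + _]] := H j.
- move=> s /gs[j [r [jn r01 sE gE]]].
  have [_ [_ _ /(_ r r01)[phi phiP]]] := H j; exists phi => k t km Kk tk ek.
  exists j => //.
  have -> : g s + gam k t - \sum_(i < j) v i = g_ j r + gam k t.
    by rewrite gE sv; vec_ring.
  exact: phiP.
Qed.

Lemma tp_cat2 K v0 v1 d c0 c1 : tagged_path K v0 d c0 -> tagged_path K v1 d c1 ->
  tagged_path K (v0 + v1) (d + 2 * (`|v0| + `|v1|)) (c0 + c1).
Proof.
move=> t0 t1.
pose v (j : nat) := if j == 0%N then v0 else v1.
pose c (j : nat) := if j == 0%N then c0 else c1.
have H j : tagged_path K (v j) d (c j) by case: j.
have [g [V [[gc g0 g1] [gd Vc gV]]]] := @tp_cat K 2 v d c isT H.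
rewrite !big_ord_recr !big_ord0/= !add0r /v /c/= in g1 Vc.
exists g, V; split=> //; split=> // s s01.
have [j [r [j2 r01 _ gj]]] := gd s s01.
have := normr_ge0 v0; have := normr_ge0 v1 => v10 v00.
have b1 : `|\sum_(i < j) v i + r *: v j| <= `|v0| + `|v1|.
  have rv (w : R * R) : `|r *: w| <= `|w|.
    by rewrite normrZ; case/andP: r01 => r0 r1; rewrite ger0_norm// ler_piMl.
  case: j j2 {gj} => [|[|//]] _.
    rewrite big_ord0 add0r /v/=; by rewrite (le_trans (rv _))// lerDl.
  by rewrite big_ord1 /v/= (le_trans (ler_normD _ _))// lerD2l.
have b2 : `|s *: (v0 + v1)| <= `|v0| + `|v1|.
  rewrite normrZ; case/andP: s01 => s0 s1; rewrite ger0_norm//.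
  by rewrite (le_trans _ (ler_normD _ _))// ler_piMl.
rewrite -(subrKA (\sum_(i < j) v i + r *: v j)).
rewrite (le_trans (ler_normD _ _))// lerD//.
by rewrite (le_trans (ler_normB _ _))//; lra.
Qed.

(** The defect [d] of a copy does not accumulate, since the end points of the copies
lie on the segment at the right times: this is why a fine zigzag stays near it. *)
Lemma tp_rep K (n : nat) v d c : (0 < n)%N -> tagged_path K v d c ->
  tagged_path K (n%:R *: v) d (n%:R * c).
Proof.
move=> n0 H.
have [g [V [[gc g0 g1] [gd Vc gV]]]] := @tp_cat K n (fun=> v) d (fun=> c) n0 (fun=> H).
exists g, V; split; first by rewrite g1 sumr_const card_ord scaler_nat.
split=> //; last by rewrite sumr_const card_ord -mulr_natl in Vc.
move=> s /gd[j [r [jn r01 sE]]].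
by rewrite sumr_const card_ord -scaler_nat -scalerDl -sE scalerA mulrC.
Qed.

End TaggedPath.

(** * The Venetian blind construction *)

Section TrigEstimates.
Context {R : realType}.

Lemma cos_le (x y : R) : 0 <= x -> x <= y -> y <= pi -> cos y <= cos x.
Proof.
move=> x0; rewrite le_eqVlt => /predU1P[->//|xy] ypi.
by rewrite ltW// ltr_cos ?in_itv//= ?x0 ?ypi ?andbT/=; lra.
Qed.

Lemma cos_pihalfB (x : R) : cos (pi / 2 - x) = sin x.
Proof. by rewrite cosB cos_pihalf sin_pihalf mul0r mul1r add0r. Qed.

Lemma common_lower_bound (n : nat) (D : R) (d_ : nat -> R) : 0 < D -> (forall k, 0 < d_ k) ->
  exists2 d, 0 < d & d <= D /\ forall k, (k < n)%N -> d <= d_ k.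
Proof.
move=> D0 dpos; elim: n => [|n [d d0 [dD dn]]]; first by exists D.
exists (Num.min d (d_ n)); first by rewrite lt_min d0 dpos.
split; first by rewrite ge_min dD.
move=> k; rewrite ltnS leq_eqVlt => /predU1P[->|kn].
  by rewrite ge_min lexx orbT.
by rewrite ge_min dn.
Qed.

(** The coefficients are those of the law of sines in the triangle whose sides have
these three directions. *)
Lemma udir_split (d w h : R) : sin (w + 2 * h) != 0 ->
  udir d = (sin (w + h) / sin (w + 2 * h)) *: udir (d + h)
         + (sin h / sin (w + 2 * h)) *: udir (d - w - h).
Proof.
move=> S0; have -> : w + 2 * h = (w + h) + h by ring.
have -> : d - w - h = d - (w + h) by ring.
have {}S0 : sin (w + h) * cos h + cos (w + h) * sin h != 0.
  by rewrite -sinD (_ : _ + _ + h = w + 2 * h)//; ring.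
apply: pair_ext; rewrite /= /GRing.scale/= !(sinD (w + h)) ?(cosD d h) ?(sinD d h) ?(cosB d) ?(sinB d).
  by field.
by field.
Qed.

Lemma udir_split' (c w h : R) : sin (w + 2 * h) != 0 ->
  udir c = (sin h / sin (w + 2 * h)) *: udir (c + w + h)
         + (sin (w + h) / sin (w + 2 * h)) *: udir (c - h).
Proof.
move=> S0; have -> : w + 2 * h = (w + h) + h by ring.
have -> : c + w + h = c + (w + h) by ring.
have {}S0 : sin (w + h) * cos h + cos (w + h) * sin h != 0.
  by rewrite -sinD (_ : _ + _ + h = w + 2 * h)//; ring.
apply: pair_ext; rewrite /= /GRing.scale/= !(sinD (w + h)) ?(cosB c) ?(sinB c) ?(cosD c) ?(sinD c).
  by field.
by field.
Qed.

End TrigEstimates.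

Section Blinds.
Context {R : realType} (m : nat) (gam : nat -> R -> R * R) (al be an : nat -> R)
  (eta B h C : R).
(* 720 is three times the constant of [cov_sweep]: an arc whose angle is within h
   of e has transversal slope at most 3 h with respect to the direction e. *)
Hypothesis C720 : 720 <= C.
Hypothesis albe : forall k, (k < m)%N -> al k < be k.
Hypothesis B0 : 0 < B.
Hypothesis h0 : 0 < h.
Hypothesis h1 : 3 * h <= 1.
Hypothesis eta0 : 0 < eta.
Hypothesis eta1 : eta <= 1.
Hypothesis heta : h <= eta / 2.
Hypothesis gamL : forall k s t, (k < m)%N -> al k <= s <= be k -> al k <= t <= be k ->
  `|gam k s - gam k t| <= B * `|s - t|.
Hypothesis gamX : forall k s t, (k < m)%N -> al k <= s <= be k -> al k <= t <= be k ->
  `|cross (gam k s - gam k t) (udir (an k))| <= h * B * `|s - t|.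

Local Notation tpath := (tagged_path m gam al be an eta).

Definition unkilled_weight (K : set nat) (k : nat) : R :=
  if `[< K k >] then 0 else B * (be k - al k).

Local Notation wt K := (\sum_(k < m) unkilled_weight K k).

Lemma unkilled_weight_ge0 K k : (k < m)%N -> 0 <= unkilled_weight K k.
Proof.
move=> km; rewrite /unkilled_weight; case: asboolP => // _.
by rewrite mulr_ge0 ?(ltW B0)// subr_ge0 ltW// albe.
Qed.

Lemma total_weight_ge0 K : 0 <= wt K.
Proof. by apply: sumr_ge0 => k _; exact: unkilled_weight_ge0. Qed.

Lemma sweep_cost_ge0 (l : R) : 0 <= C * h * `|l|.
Proof. exact: mulr_ge0 (mulr_ge0 (le_trans (ler0n _ _) C720) (ltW h0)) (normr_ge0 l). Qed.

(** A step of the induction: the arcs in [K'] but not in [K] are nearly parallel to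
the segment, so they are paid for by the sweep along the segment itself. A path
for [K'] that stays in the neighbourhood where this covering is valid then
serves for [K]. *)
Lemma tp_kill K K' (e l d X : R) : K `<=` K' ->
  (forall k, (k < m)%N -> K' k -> ~ K k -> `|sin (an k - e)| <= h) ->
  l != 0 -> C * h * `|l| <= X ->
  (forall d : R, 0 < d -> tpath K' (l *: udir e) d (X * wt K')) -> 0 < d ->
  tpath K (l *: udir e) d (X * wt K).
Proof.
move=> KK' Ksin l0 lX tK' d0.
have X0 : 0 <= X := le_trans (sweep_cost_ge0 l) lX.
pose S (k : nat) (dk : R) := [set z | [/\ (k < m)%N, K' k, ~ K k & exists t r : R,
  [/\ al k <= t <= be k, 0 <= r <= 1
    & `|z - (gam k t + r *: (l *: udir e))| <= dk]]].
have Sk k : exists dk : R, 0 < dk /\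
    ((k < m)%N -> covered_area (S k dk) (X * (unkilled_weight K k - unkilled_weight K' k))).
  have [[km K'k Kk]|nk] := pselect [/\ (k < m)%N, K' k & ~ K k]; last first.
    exists 1; split=> // km; apply: cov_sub cov0; first by move=> z [? ? ? _]; exact: nk.
    rewrite mulr_ge0// subr_ge0.
    have [K'k|nK'k] := pselect (K' k).
      by rewrite {1}/unkilled_weight asboolT// unkilled_weight_ge0.
    by rewrite /unkilled_weight !asboolF// => /KK'.
  have kap0 : 0 < 3 * h by rewrite mulr_gt0.
  have gamX' s t : al k <= s <= be k -> al k <= t <= be k ->
     `|cross (gam k s - gam k t) (udir e)| <= 3 * h * B * `|s - t|.
    move=> sk tk; apply: le_trans (cross_rot _ (an k) e) _.
    have H1 := gamX km sk tk; have H2 := gamL km sk tk.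
    have H3 : `|sin (e - an k)| <= h by rewrite -normrN -sinN opprB Ksin.
    have : `|gam k s - gam k t| * `|sin (e - an k)| <= B * `|s - t| * h.
      by rewrite ler_pM.
    by lra.
  have [dk dk0 Hk] := @cov_sweep _ (gam k) _ _ B (3 * h) e l (albe km) B0 kap0 h1 l0
     (fun s t => @gamL k s t km) gamX'.
  exists dk; split=> // _; apply: cov_sub Hk.
    by move=> z [_ _ _ ?].
  rewrite /unkilled_weight; case: asboolP => // _; case: asboolP => // _.
  rewrite subr0; have -> : 240 * (3 * h) * (B * (be k - al k)) * `|l| =
    720 * (h * `|l|) * (B * (be k - al k)) by ring.
  apply: ler_wpM2r; first by rewrite mulr_ge0 ?(ltW B0)// subr_ge0 ltW// albe.
  apply: le_trans lX; rewrite -mulrA; apply: ler_wpM2r C720.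
  by rewrite mulr_ge0// ltW.
have [dk_ /all_and2[dk0 dkP]] := choice Sk.
have [d' d'0 [d'd d'dk]] := common_lower_bound m d0 dk0.
have [g [V [[gc g0 g1] [gd Vc gV]]]] := tK' _ d'0.
exists g, ([set z | exists2 k, (k < m)%N & S k (dk_ k) z] `|` V); split=> //; split.
- by move=> s /gd /le_trans; apply.
- have -> : X * wt K = \sum_(k < m) X * (unkilled_weight K k - unkilled_weight K' k) + X * wt K'.
    by rewrite -mulr_sumr -mulrDr sumrB subrK.
  apply: covU => //.
  apply: (@cov_bigU _ m (fun k => S k (dk_ k))
    (fun k => X * (unkilled_weight K k - unkilled_weight K' k))).
  by move=> k km; exact: dkP.
- move=> s s01; have [phi phiP] := gV s s01; exists phi => k t km Kk tk ek.
  have [K'k|nK'k] := pselect (K' k); last by right; exact: phiP.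
  left; exists k => //; split=> //; exists t, s; split=> //.
  rewrite (_ : _ - _ = g s - s *: (l *: udir e)); last by vec_ring.
  by apply: le_trans (gd _ s01) _; exact: d'dk.
Qed.

(** Angles count modulo pi, so an interval of length pi - eta leaves only the
directions in an interval of length eta. *)
Definition killed (c d : R) : set nat := [set k | exists z : int, c <= an k + z%:~R * pi <= d].

Local Notation D := (sin (eta / 2) * sin (eta / 4))^-1.

(** For a segment of length 1 with killed angles [c, d], [length_factor (d - c)]
bounds the total length of the segments along which a given arc will be swept. It
solves the recurrence given by the law of sines, and the constant in front makes
it at least 1 until the branches stop. *)
Definition length_factor (w : R) := D * cos (w / 2) * cos ((w + h) / 2).

Local Notation T := length_factor.

Local Notation pi2 := (pi_ge2 R).

Lemma sin_eta2 : 0 < sin (eta / 2).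
Proof. by apply: sin_gt0_pi; move: eta0 eta1 pi2; lra. Qed.

Lemma sin_eta4 : 0 < sin (eta / 4).
Proof. by apply: sin_gt0_pi; move: eta0 eta1 pi2; lra. Qed.

Lemma length_const_gt0 : 0 < D.
Proof. by rewrite invr_gt0 mulr_gt0 ?sin_eta2 ?sin_eta4. Qed.

Lemma length_factor_ge1 w : 0 <= w -> w <= pi - eta -> 1 <= T w.
Proof.
move=> w0 wpi.
have c1 : sin (eta / 2) <= cos (w / 2).
  by rewrite -cos_pihalfB; apply: cos_le; move: eta0 eta1 pi2; lra.
have c2 : sin (eta / 4) <= cos ((w + h) / 2).
  by rewrite -cos_pihalfB; apply: cos_le; move: h0 heta eta0 eta1 pi2; lra.
rewrite /length_factor -mulrA mulrC ler_pdivlMr ?mulr_gt0 ?sin_eta2 ?sin_eta4//.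
by rewrite mul1r ler_pM// ltW ?sin_eta2 ?sin_eta4.
Qed.

Lemma length_factor_le w : T w <= D.
Proof.
rewrite /length_factor -mulrA; apply: ler_piMr (ltW length_const_gt0) _.
apply: le_trans (ler_norm _) _; rewrite normrM mulr_ile1// cos_max//.
Qed.

(** The integer [n] counts the remaining rotation steps; the hypothesis on [e] says
that the branch travels along one end of the interval of killed angles. *)
Lemma tp_blinds (n : nat) (c d e l del : R) : c <= d -> d - c + n%:R * h = pi - eta ->
  e = c \/ e = d -> l != 0 -> 0 < del ->
  tpath (killed c d) (l *: udir e) del (C * h * `|l| * T (d - c) * wt (killed c d)).
Proof.
elim: n c d e l del => [|n IH] c d e l del cd dcn ecd l0 del0.
  exists (fun s => s *: (l *: udir e)), set0; split; [split|split].
  - by move=> s; exact: scalel_continuous.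
  - by rewrite scale0r.
  - by rewrite scale1r.
  - by move=> s _; rewrite subrr normr0 ltW.
  - apply: cov_sub cov0 => //; apply: mulr_ge0 (total_weight_ge0 _).
    apply: mulr_ge0 (sweep_cost_ge0 _) _.
    by rewrite (le_trans ler01)// length_factor_ge1 ?subr_ge0//; move: dcn; lra.
  - move=> s _; exists d => k t km nK _; rewrite ltNge => /negP[].
    (* The angles that remain lie between d and c + pi = d + eta. *)
    have [z /andP[z0 zpi]] := modpi_ex (an k - c).
    rewrite -(sinD_intpi _ z) (le_trans (sin_norm_le _))//.
    have dz : d < an k + z%:~R * pi.
      by rewrite ltNge; apply/negP => zd; apply: nK; exists z; apply/andP; split; lra.
    rewrite ger0_norm; lra.
set w := d - c in dcn *.
have w0 : 0 <= w by rewrite subr_ge0.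
have nh : 0 <= n%:R * h by rewrite mulr_ge0// ltW.
have dcn' : w + h + n%:R * h = pi - eta by rewrite -dcn -natr1; ring.
have wh : w + h <= pi - eta by lra.
have S0 : 0 < sin (w + 2 * h).
  by apply: sin_gt0_pi; move: h0 heta eta0; lra.
have Sh : 0 < sin h by apply: sin_gt0_pi; move: h0 h1 pi2; lra.
have Swh : 0 < sin (w + h) by apply: sin_gt0_pi; move: h0 heta eta0; lra.
have Twh1 : 1 <= T (w + h) by apply: length_factor_ge1 => //; move: h0; lra.
set K := killed c d.
have child1 (l' del' : R) : l' != 0 -> 0 < del' ->
    tpath K (l' *: udir (d + h)) del' (C * h * `|l'| * T (w + h) * wt K).
  move=> l'0 del'0; apply: (@tp_kill _ (killed c (d + h))) => //.
  - by move=> k [z /andP[zc zd]]; exists z; rewrite zc/= (le_trans zd)// lerDl ltW.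
  - move=> k km [z /andP[zc zd]] nK; rewrite -(sinD_intpi _ z).
    have dz : d < an k + z%:~R * pi.
      by rewrite ltNge; apply/negP => zd'; apply: nK; exists z; rewrite zc.
    by rewrite (le_trans (sin_norm_le _))// ler_norml; apply/andP; split; lra.
  - exact: ler_peMr (sweep_cost_ge0 _) _.
  - move=> de de0; have -> : w + h = d + h - c by rewrite /w; ring.
    apply: IH => //; [by move: h0; lra| |by right].
    by rewrite -dcn' /w; ring.
have child2 (l' del' : R) : l' != 0 -> 0 < del' ->
    tpath K (l' *: udir (c - h)) del' (C * h * `|l'| * T (w + h) * wt K).
  move=> l'0 del'0; apply: (@tp_kill _ (killed (c - h) d)) => //.
  - by move=> k [z /andP[zc zd]]; exists z; rewrite zd andbT lerBlDr (le_trans zc)// lerDl ltW.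
  - move=> k km [z /andP[zc zd]] nK; rewrite -(sinD_intpi _ z).
    have dz : an k + z%:~R * pi < c.
      by rewrite ltNge; apply/negP => zd'; apply: nK; exists z; rewrite zd andbT.
    by rewrite (le_trans (sin_norm_le _))// ler_norml; apply/andP; split; lra.
  - exact: ler_peMr (sweep_cost_ge0 _) _.
  - move=> de de0; have -> : w + h = d - (c - h) by rewrite /w; ring.
    apply: IH => //; [by move: h0; lra| |by left].
    by rewrite -dcn' /w; ring.
pose a := sin (w + h) / sin (w + 2 * h); pose b := sin h / sin (w + 2 * h).
have a0 : 0 < a by rewrite divr_gt0.
have b0 : 0 < b by rewrite divr_gt0.
(* The lengths of the two branches add up to a + b times the length of the
   segment, and the length factor absorbs exactly this growth. *)
have Tab : T (w + h) * (a + b) = T w.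
  pose p := w / 2; pose s := p + h.
  have w2h : w + 2 * h = s + s by rewrite /s /p; field.
  have S2 : sin (w + 2 * h) = 2 * (sin s * cos s) by rewrite w2h sinD; ring.
  have : sin s * cos s != 0.
    by apply: contra_ltN S0 => /eqP sc0; rewrite S2 sc0 mulr0.
  rewrite mulf_eq0 negb_or => /andP[ss0 cs0].
  rewrite /length_factor /a /b; move: D => Dinv.
  have -> : (w + h + h) / 2 = s by rewrite /s /p; field.
  have -> : w / 2 = p by [].
  rewrite S2; have -> : w + h = s + p :> R by rewrite /s /p; field.
  have -> : h = s - p by rewrite /s; ring.
  by rewrite (sinB s p) (sinD s p); field; rewrite ?cs0 ?ss0.
have [N N0 Nl] : exists2 N, (0 < N)%N & 2 * (`|l| * (a + b)) <= del / 2 * N%:R.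
  exists (Num.truncn (2 * (`|l| * (a + b)) / (del / 2))).+1 => //.
  by rewrite -ler_pdivrMl ?divr_gt0// mulrC ltW// truncnS_gt.
have NR0 : 0 < N%:R :> R by rewrite ltr0n.
have del20 : 0 < del / 2 by rewrite divr_gt0.
have pieces (e1 e2 a' b' : R) : 0 < a' -> 0 < b' -> a' + b' = a + b ->
    udir e = a' *: udir e1 + b' *: udir e2 ->
    (forall l' del' : R, l' != 0 -> 0 < del' ->
      tpath K (l' *: udir e1) del' (C * h * `|l'| * T (w + h) * wt K)) ->
    (forall l' del' : R, l' != 0 -> 0 < del' ->
      tpath K (l' *: udir e2) del' (C * h * `|l'| * T (w + h) * wt K)) ->
    tpath K (l *: udir e) del (C * h * `|l| * T w * wt K).
  move=> a'0 b'0 ab uE H1 H2.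
  have la0 : l / N%:R * a' != 0.
    apply: mulf_neq0; last by rewrite gt_eqF.
    by apply: mulf_neq0 => //; rewrite invr_eq0 gt_eqF.
  have lb0 : l / N%:R * b' != 0.
    apply: mulf_neq0; last by rewrite gt_eqF.
    by apply: mulf_neq0 => //; rewrite invr_eq0 gt_eqF.
  have := tp_rep N0 (tp_cat2 (H1 _ _ la0 del20) (H2 _ _ lb0 del20)).
  have -> : N%:R *: ((l / N%:R * a') *: udir e1 + (l / N%:R * b') *: udir e2) = l *: udir e.
    rewrite uE scalerDr !scalerA [RHS]scalerDr !scalerA.
    by congr (_ *: _ + _ *: _); field; rewrite gt_eqF.
  apply: tp_weak.
  - have n1 := norm_Zudir (l / N%:R * a') e1.
    have n2 := norm_Zudir (l / N%:R * b') e2.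
    have : 2 * (`|l / N%:R * a'| + `|l / N%:R * b'|) <= del / 2.
      rewrite !normrM (gtr0_norm a'0) (gtr0_norm b'0) -mulrDr ab normfV (gtr0_norm NR0).
      by rewrite mulrAC mulrA ler_pdivrMr.
    by lra.
  - rewrite !normrM (gtr0_norm a'0) (gtr0_norm b'0) normfV (gtr0_norm NR0).
    rewrite -Tab -ab [leLHS](_ : _ = C * h * `|l| * (T (w + h) * (a' + b')) * wt K)//.
    by field; rewrite gt_eqF.
case: ecd => eE; rewrite eE in pieces *.
- apply: (pieces _ _ b a) child1 child2 => //; first by rewrite addrC.
  have -> : d + h = c + w + h by rewrite /w; ring.
  by apply: udir_split'; rewrite gt_eqF.
- apply: (pieces _ _ a b) child1 child2 => //.
  have -> : c - h = d - w - h by rewrite /w; ring.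
  by apply: udir_split; rewrite gt_eqF.
Qed.

(** At the start no angle is killed except that of the segment, whose arcs
[tp_kill] takes care of. *)
Lemma tp_start (n : nat) (e l del : R) : n%:R * h = pi - eta -> l != 0 -> 0 < del ->
  tpath set0 (l *: udir e) del (C * h * `|l| * D * wt set0).
Proof.
move=> nh l0 del0.
have D1 : 1 <= D.
  have p0 : 0 <= pi - eta by move: eta1 pi2; lra.
  by apply: le_trans (length_factor_ge1 (lexx 0) p0) (length_factor_le _).
apply: (@tp_kill _ (killed e e)) => //.
- move=> k km [z /andP[ez ze]] _; rewrite -(sinD_intpi _ z).
  have -> : an k - e + z%:~R * pi = 0 by lra.
  by rewrite sin0 normr0 ltW.
- exact: ler_peMr (sweep_cost_ge0 _) D1.
- move=> d d0; apply: tp_weak (@tp_blinds n e e e l d _ _ _ _ _) => //.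
  + apply: ler_wpM2r (total_weight_ge0 _) _ _ _.
    apply: ler_wpM2l (sweep_cost_ge0 _) _ _ _; exact: length_factor_le.
  + by rewrite subrr add0r.
  + by left.
Qed.

Lemma start_cost_ge0 : 0 <= C * h * D * wt set0.
Proof.
apply: mulr_ge0 (total_weight_ge0 _); apply: mulr_ge0 (ltW length_const_gt0).
exact: mulr_ge0 (le_trans (ler0n _ _) C720) (ltW h0).
Qed.

Lemma tp_axis (n : nat) (e l del : R) : n%:R * h = pi - eta -> 0 < del ->
  tpath set0 (l *: udir e) del (C * h * D * wt set0 * (`|l| + 1)).
Proof.
move=> nh del0; have Q0 := start_cost_ge0.
have start l' d : l' != 0 -> 0 < d ->
    tpath set0 (l' *: udir e) d (C * h * D * wt set0 * `|l'|).
  move=> l'0 d0; have := tp_start e nh l'0 d0; apply: tp_weak => //.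
  by rewrite le_eqVlt; apply/orP; left; apply/eqP; ring.
have [->|l0] := eqVneq l 0; last first.
  by apply: tp_weak (start _ _ l0 del0) => //; rewrite ler_wpM2l// lerDl.
(* A vanishing displacement is made of a short motion forth and back. *)
pose tau := Num.min (del / 8) (1 / 2).
have tau0 : 0 < tau by rewrite lt_min !divr_gt0.
have tau1 : tau <= del / 8 by rewrite /tau ge_min lexx.
have tau2 : tau <= 1 / 2 by rewrite /tau ge_min lexx orbT.
have ntau0 : - tau != 0 by rewrite oppr_eq0 gt_eqF.
have del20 : 0 < del / 2 by rewrite divr_gt0.
have := tp_cat2 (start _ _ (lt0r_neq0 tau0) del20) (start _ _ ntau0 del20).
rewrite -scalerDl subrr; apply: tp_weak.
  have := norm_Zudir tau e; have := norm_Zudir (- tau) e.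
  by rewrite normrN gtr0_norm//; lra.
by rewrite -mulrDr normrN normr0 gtr0_norm// ler_wpM2l//; lra.
Qed.

Lemma tp_vector (n : nat) (v : R * R) (del : R) : n%:R * h = pi - eta -> 0 < del ->
  tpath set0 v (del + 4 * `|v|) (C * h * D * wt set0 * (2 * `|v| + 2)).
Proof.
move=> nh del0.
have := tp_cat2 (tp_axis 0 v.1 nh del0) (tp_axis (pi / 2) v.2 nh del0).
have -> : v.1 *: udir 0 + v.2 *: udir (pi / 2) = v.
  rewrite /udir cos0 sin0 cos_pihalf sin_pihalf.
  by apply: pair_ext; rewrite /= /GRing.scale/=; ring.
have v1 := norm_fst_le v; have v2 := norm_snd_le v.
apply: tp_weak.
  have := norm_Zudir v.1 0; have := norm_Zudir v.2 (pi / 2); lra.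
rewrite -mulrDr; apply: ler_wpM2l start_cost_ge0 _ _ _; lra.
Qed.

(** Any continuous path is uniformly approximated by the blinds built on a staircase
along it. The number of stairs depends on [f] and [del] only, hence the area is
still proportional to the angular step [h]. *)
Lemma tp_follow (n N : nat) (f : R -> R * R) (del : R) : n%:R * h = pi - eta ->
  0 < del -> (0 < N)%N ->
  (forall s t : R, 0 <= s <= 1 -> 0 <= t <= 1 -> `|s - t| <= N%:R^-1 ->
     `|f s - f t| <= del / 20) ->
  exists (g : R -> R * R) V, [/\ continuous g, forall s : R, 0 <= s <= 1 -> `|g s - f s| <= del,
     covered_area V (N%:R * (2 * del + 2) * (C * h * D * wt set0)) &
     tagged m gam al be an eta set0 g V].
Proof.
move=> nh del0 N0 fN.
have NR0 : 0 < N%:R :> R by rewrite ltr0n.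
pose p (j : nat) := f (j%:R / N%:R).
pose v (j : nat) := if (j < N)%N then p j.+1 - p j else 0.
have jN (j : nat) : (j <= N)%N -> 0 <= (j%:R / N%:R : R) <= 1.
  by move=> jN; rewrite divr_ge0//= ler_pdivrMr// mul1r ler_nat.
have vdel j : `|v j| <= del / 20.
  rewrite /v; case: ifPn => jltN; last by rewrite normr0 divr_ge0// ltW.
  apply: fN; [exact: jN|exact/jN/ltnW|].
  rewrite -mulrBl -natr1 [_ + 1 - _](_ : _ = 1); last by ring.
  by rewrite mul1r normfV gtr0_norm.
have del20 : 0 < del / 20 by rewrite divr_gt0.
have tv j : tpath set0 (v j) (del / 4) (C * h * D * wt set0 * (2 * del + 2)).
  apply: tp_weak (tp_vector (v j) nh del20); first by have := vdel j; lra.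
  by apply: ler_wpM2l start_cost_ge0 _ _ _; have := vdel j; lra.
have [g [V [[gc g0 g1] [gs cV gV]]]] := tp_cat N0 tv.
have sumv j : (j <= N)%N -> \sum_(i < j) v i = p j - f 0.
  elim: j => [|j IH] jN'; first by rewrite big_ord0 /p mul0r subrr.
  rewrite big_ord_recr/= IH 1?ltnW// /v jN'; vec_ring.
exists (fun s => f 0 + g s), [set z | V (z - f 0)]; split.
- by move=> s; apply: cvgD; [exact: cvg_cst|exact: gc].
- move=> s s01; have [j [r [jltN /andP[r0 r1] sE gE]]] := gs s s01.
  rewrite sumv ?(ltnW jltN)// in gE.
  have sj : `|j%:R / N%:R - s| <= N%:R^-1.
    have -> : s = (j%:R + r) / N%:R by rewrite -sE mulrAC divff ?mul1r// gt_eqF.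
    rewrite -mulrBl normrM normfV (gtr0_norm NR0).
    apply: ler_piMl; first by rewrite invr_ge0 ltW.
    by rewrite ler_norml; apply/andP; split; lra.
  have fs := fN _ _ (jN _ (ltnW jltN)) s01 sj.
  have rv : `|r *: v j| <= del / 20.
    by rewrite normrZ ger0_norm// (le_trans _ (vdel j))// ler_piMl.
  rewrite (_ : f 0 + g s - f s = (g s - (p j - f 0 + r *: v j)) + ((p j - f s) + r *: v j)); last by vec_ring.
  have := ler_normD (p j - f s) (r *: v j).
  have := ler_normD (g s - (p j - f 0 + r *: v j)) ((p j - f s) + r *: v j).
  by rewrite -/(p j) in fs *; lra.
- apply: cov_translate; apply: cov_sub cV => //.
  by rewrite sumr_const card_ord -[_ *+ N]mulr_natl le_eqVlt; apply/orP; left; apply/eqP; ring.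
- move=> s s01; have [phi phiP] := gV s s01; exists phi => k t km nK tk ek.
  by rewrite /= (_ : _ - _ = g s + gam k t); [exact: phiP|vec_ring].
Qed.

End Blinds.

(** * Differentiable curves on a segment *)

Section SegmentAnalysis.
Context {R : realType}.

Lemma within_continuousP (V : normedModType R) (f : R -> V) (a b : R) :
  {within `[a, b], continuous f} <->
  (forall x e : R, a <= x <= b -> 0 < e -> exists2 d : R, 0 < d &
    forall y, a <= y <= b -> `|x - y| < d -> `|f x - f y| < e).
Proof.
rewrite subspace_continuousP; split=> [cf x e xab e0|H x /=].
  have := cf x; rewrite /= in_itv/= => /(_ xab)/cvgrPdist_lt/(_ e e0) [d /= d0 dP].
  by exists d => // y yab xy; apply: dP => //=; rewrite in_itv.
rewrite in_itv/= => xab; apply/cvgrPdist_lt => e e0.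
have [d d0 dP] := H x e xab e0.
by exists d => //= y xy; rewrite in_itv/= => yab; exact: dP.
Qed.

Lemma within_uniform (V : normedModType R) (f : R -> V) (a b : R) :
  {within `[a, b], continuous f} ->
  forall e : R, 0 < e -> exists2 d : R, 0 < d & forall x y, a <= x <= b ->
    a <= y <= b -> `|x - y| < d -> `|f x - f y| < e.
Proof.
move=> /within_continuousP cf e e0.
have /compact_near_coveringP cover := @segment_compact R a b.
have : \forall d \near (0 : R)^'+, `[a, b] `<=` [set x | a <= x <= b ->
    forall y, a <= y <= b -> `|x - y| < d -> `|f x - f y| < e].
  apply: cover => x; rewrite /= in_itv/= => xab.
  have e20 : 0 < e / 2 by rewrite divr_gt0.
  have [d d0 dP] := cf x (e / 2) xab e20.
  have d20 : 0 < d / 2 by rewrite divr_gt0.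
  exists (ball x (d / 2), [set d' | d' < d / 2]) => /=.
    by split; [exact: nbhsx_ballx|exact: nbhs_right_lt].
  move=> [x' d'] /= [xx' d'd] x'ab y yab x'y.
  have xx'd : `|x - x'| < d by rewrite /ball/= in xx'; move: xx'; lra.
  have xyd : `|x - y| < d.
    rewrite -(subrKA x') (le_lt_trans (ler_normD _ _))//.
    by rewrite /ball/= in xx'; move: xx'; lra.
  rewrite -(subrKA (f x)) (le_lt_trans (ler_normD _ _))//.
  by rewrite (distrC (f x')); have := dP _ x'ab xx'd; have := dP _ yab xyd; lra.
move=> [d /= d0 dP]; exists (d / 2); first by rewrite divr_gt0.
move=> x y xab yab xy; apply: (dP (d / 2)) => //=.
- by rewrite sub0r normrN gtr0_norm ?divr_gt0// ltr_pdivrMr// ltr_pMr// ltr1n.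
- by rewrite divr_gt0.
Qed.

(** One-sided at the end points, like the limits in [C1_param]. *)
Definition deriv_on (V : normedModType R) (a b : R) (g dg : R -> V) :=
  forall t e : R, a <= t <= b -> 0 < e -> exists2 d : R, 0 < d &
  forall s, a <= s <= b -> `|s - t| < d ->
    `|g s - g t - (s - t) *: dg t| <= e * `|s - t|.

Lemma C1_param_deriv_on (a b : R) (g dg : R -> R * R) :
  C1_param a b g dg -> deriv_on a b g dg.
Proof.
move=> [_ gd _ _] t e tab e0.
have := gd t; rewrite /= in_itv/= => /(_ tab)/cvgrPdist_lt/(_ e e0).
rewrite /= near_withinE near_withinE => -[d /= d0 dP]; exists d => // s sab st.
have [->|nst] := eqVneq s t.
  by rewrite !subrr scale0r subr0 !normr0 mulr0.
have st0 : s - t != 0 by rewrite subr_eq0.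
have -> : g s - g t - (s - t) *: dg t =
   (- (s - t)) *: (dg t - (s - t)^-1 *: (g s - g t)).
  by rewrite scaleNr scalerBr scalerA mulfV// scale1r opprB.
rewrite normrZ normrN mulrC ler_wpM2r// ltW//; apply: dP => //=.
by rewrite distrC.
Qed.

Lemma mean_value_le (a b x y K : R) (f df : R -> R) : deriv_on a b f df ->
  a <= x -> x <= y -> y <= b -> (forall t, x <= t <= y -> `|df t| <= K) ->
  `|f y - f x| <= K * (y - x).
Proof.
move=> fd ax xy yb dfK.
have fder z : z \in `]x, y[%R -> is_derive z 1 f (df z).
  rewrite in_itv/= => /andP[xz zy]; apply/is_derive1_caratheodory.
  exists (fun s => if s == z then df z else (f s - f z) / (s - z)); split.
  - move=> s; case: eqVneq => [->|sz]; first by rewrite !subrr mulr0.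
    by rewrite divfK// subr_eq0.
  - apply/cvgrPdist_le => e e0 /=; rewrite eqxx.
    have zab : a <= z <= b by apply/andP; split; lra.
    have [d d0 dP] := fd z e zab e0.
    exists (Num.min d (Num.min (z - x) (y - z))) => /=.
      by rewrite !lt_min d0 !subr_gt0 xz zy.
    move=> s; rewrite /= !lt_min => /andP[sd /andP[sx sy]].
    case: eqVneq => [_|sz]; first by rewrite subrr normr0 ltW.
    have sab : a <= s <= b.
      by move: sx sy; rewrite !ltr_norml => /andP[? ?] /andP[? ?]; apply/andP; split; lra.
    have sz0 : s - z != 0 by rewrite subr_eq0.
    rewrite -(ler_pM2r (_ : 0 < `|s - z|)) ?normr_gt0// -normrM.
    rewrite mulrBl divfK// distrC (mulrC (df z)).
    by apply: dP => //; rewrite distrC.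
  - by rewrite eqxx.
have fcont : {within `[x, y], continuous f}.
  apply/within_continuousP => t e /andP[xt ty] e0.
  have tab : a <= t <= b by apply/andP; split; lra.
  have [d d0 dP] := fd t 1 tab ltr01.
  have K0 : 0 <= K by apply: le_trans (dfK t _); rewrite ?xt.
  exists (Num.min d (e / (K + 2))).
    by rewrite lt_min d0 divr_gt0// ltr_wpDl.
  move=> s /andP[xs sy]; rewrite lt_min => /andP[td te].
  have sab : a <= s <= b by apply/andP; split; lra.
  have := dP s sab; rewrite (distrC s) => /(_ td) H.
  have H2 : `|(s - t) *: df t| <= `|t - s| * K.
    by rewrite normrZ (distrC s) ler_wpM2l// dfK// xt.
  move: te; rewrite ltr_pdivlMr ?ltr_wpDl// => te.
  rewrite distrC -(subrK ((s - t) *: df t) (f s - f t)).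
  have := ler_normD (f s - f t - (s - t) *: df t) ((s - t) *: df t).
  have := normr_ge0 (t - s).
  by have [->|ts0] := eqVneq (`|t - s|) 0; nra.
have [c /[1!in_itv]/= cxy ->] := MVT_segment xy fder fcont.
have yx0 : 0 <= y - x by rewrite subr_ge0.
by rewrite normrM (ger0_norm yx0) ler_wpM2r// dfK.
Qed.

(** The functional [L] is meant to be a coordinate or the transversal component
[cross _ (udir a)]. *)
Lemma functional_lipschitz (a b x y K : R) (g dg : R -> R * R)
    (L : R * R -> R) (M : R) :
  (forall v w, L (v - w) = L v - L w) -> (forall r v, L (r *: v) = r * L v) ->
  deriv_on a b g dg -> (forall v, `|L v| <= M * `|v|) ->
  (forall t, x <= t <= y -> `|L (dg t)| <= K) -> a <= x -> y <= b ->
  forall s t, x <= s <= y -> x <= t <= y -> `|L (g s - g t)| <= K * `|s - t|.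
Proof.
move=> LB LZ gd LM LK ax yb.
have Ld : deriv_on a b (L \o g : R -> R) (L \o dg).
  move=> t e tab e0.
  have M0 : 0 < `|M| + 1 by rewrite ltr_wpDl.
  have [d d0 dP] := gd t (e / (`|M| + 1)) tab (divr_gt0 e0 M0).
  exists d => // s sab st.
  have -> : (L \o g) s - (L \o g) t - (s - t) *: (L \o dg) t =
            L (g s - g t - (s - t) *: dg t).
    by rewrite /= !LB LZ.
  apply: le_trans (LM _) _; have := dP s sab st.
  rewrite mulrAC ler_pdivlMr// => H.
  have := ler_norm M; have := normr_ge0 (g s - g t - (s - t) *: dg t).
  by nra.
move=> s t /andP[xs sy] /andP[xt ty].
have H u v : x <= u -> u <= v -> v <= y -> `|L (g v - g u)| <= K * (v - u).
  move=> xu uv vy; rewrite LB.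
  apply: (@mean_value_le a b u v K _ _ Ld); [lra|lra|lra|].
  by move=> r /andP[ur rv]; apply: LK; apply/andP; split; lra.
have [st|/ltW st] := leP s t.
  have ts : `|t - s| = t - s by rewrite ger0_norm ?subr_ge0.
  by rewrite LB distrC -LB (distrC s) ts; apply: H.
have ts' : `|s - t| = s - t by rewrite ger0_norm ?subr_ge0.
by rewrite ts'; apply: H.
Qed.

End SegmentAnalysis.

(** * Cutting curves into nearly straight arcs *)

Section Pieces.
Context {R : realType}.

(** The last condition is the integrated form of the requirement that the tangents
of the [k]-th arc stay within [h] of the direction [an k]. *)
Definition straight_arcs (m : nat) (gam : nat -> R -> R * R) (al be an : nat -> R)
  (B h : R) : Prop :=
  [/\ forall k, (k < m)%N -> al k < be k,
      forall k s t, (k < m)%N -> al k <= s <= be k -> al k <= t <= be k ->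
        `|gam k s - gam k t| <= B * `|s - t|
    & forall k s t, (k < m)%N -> al k <= s <= be k -> al k <= t <= be k ->
        `|cross (gam k s - gam k t) (udir (an k))| <= h * B * `|s - t|].

Definition cut_into (m : nat) (gam : nat -> R -> R * R) (al be an : nat -> R)
  (h : R) (a b : R) (g dg : R -> R * R) : Prop :=
  forall t, a <= t <= b -> exists2 k, (k < m)%N &
    [/\ al k <= t <= be k, gam k t = g t
      & forall r c, r != 0 -> dg t = r *: udir c -> `|sin (c - an k)| <= h].

Lemma speed_bounds (a b : R) (g dg : R -> R * R) : C1_param a b g dg ->
  exists B b0 : R, 0 < b0 /\ forall t, a <= t <= b -> b0 <= `|dg t| <= B.
Proof.
move=> [ab _ dgc dg0].
have nc : {within `[a, b], continuous (fun t => `|dg t|)}.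
  apply/within_continuousP => x e xab e0.
  have [d d0 dP] := (within_continuousP _ _ _).1 dgc x e xab e0.
  exists d => // y yab xy; apply: le_lt_trans (ler_dist_dist _ _) _.
  exact: dP.
have [c1 c1ab max1] := EVT_max (ltW ab) nc.
have [c2 c2ab min2] := EVT_min (ltW ab) nc.
exists `|dg c1|, `|dg c2|; split.
  by rewrite normr_gt0; apply: dg0; exact: c2ab.
by move=> t tab; rewrite min2 ?max1// in_itv.
Qed.

(** The constant [B] must not depend on the fineness [h]: the area of a stage is of
order h * B * (b - a), and tends to 0 with [h]. *)
Lemma curve_arcs (a b : R) (g dg : R -> R * R) : C1_param a b g dg ->
  exists2 B : R, 0 < B & forall h, 0 < h -> exists m gam al be an,
    [/\ straight_arcs m gam al be an B h, \sum_(k < m) (be k - al k) <= b - a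
      & cut_into m gam al be an h a b g dg].
Proof.
move=> C1; have [B [b0 [b00 bB]]] := speed_bounds C1.
have gder := C1_param_deriv_on C1.
have [ab _ dgc dg0] := C1.
have aab : a <= a <= b by rewrite lexx ltW.
have b0B : b0 <= B by have /andP[] := bB a aab; exact: le_trans.
have B0 : 0 < B := lt_le_trans b00 b0B.
exists B => // h h0.
have hb0 : 0 < h * b0 / 2 by rewrite divr_gt0// mulr_gt0.
have [d d0 dP] := within_uniform dgc hb0.
have ba0 : 0 < b - a by rewrite subr_gt0.
pose n := (Num.truncn ((b - a) / d)).+1.
pose rho := (b - a) / n%:R.
have n0 : 0 < n%:R :> R by rewrite ltr0n.
have nrho : n%:R * rho = b - a by rewrite /rho mulrC divfK// gt_eqF.
have rho0 : 0 < rho by rewrite divr_gt0.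
have rhod : rho < d.
  by rewrite /rho ltr_pdivrMr// mulrC -ltr_pdivrMr// truncnS_gt.
pose al (j : nat) := a + j%:R * rho.
pose be (j : nat) := al j + rho.
have alb j : (j < n)%N -> a <= al j /\ be j <= b.
  move=> jn; have : (j%:R + 1) * rho <= n%:R * rho.
    by rewrite ler_pM2r// natr1 ler_nat.
  have : 0 <= j%:R * rho by rewrite mulr_ge0// ltW.
  by rewrite nrho /be /al mulrDl mul1r; split; lra.
have /choice[an anP] j : exists c : R, (j < n)%N ->
    exists r, dg (al j) = r *: udir c.
  have [jn|_] := boolP (j < n)%N; last by exists 0.
  have [aj jb] := alb j jn.
  have /polar_ex[c [r [_ E]]] : dg (al j) != 0.
    by apply: dg0; rewrite /= in_itv/= aj/=; move: jb rho0; rewrite /be; lra.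
  by exists c => _; exists r.
have crossdg j t : (j < n)%N -> al j <= t <= be j ->
    `|cross (dg t) (udir (an j))| <= h * b0.
  move=> jn /andP[jt tj]; have [aj jb] := alb j jn.
  have [r E] := anP j jn.
  have -> : cross (dg t) (udir (an j)) = cross (dg t - dg (al j)) (udir (an j)).
    by rewrite crossBl E crossZl cross_udir subrr sin0 mulr0 subr0.
  have h1 : a <= t <= b by apply/andP; split; lra.
  have h2 : a <= al j <= b by apply/andP; split; move: rho0; rewrite /be in tj jb; lra.
  have h3 : `|t - al j| < d.
    by rewrite ger0_norm ?subr_ge0//; rewrite /be in tj; lra.
  have := cross_le (dg t - dg (al j)) (an j).
  by have := dP _ _ h1 h2 h3; lra.
exists n, (fun=> g), al, be, an; split; first split.
- by move=> k _; rewrite /be ltrDl.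
- move=> k s t kn sk tk; have [aj jb] := alb k kn.
  have lip L : (forall v w, L (v - w) = L v - L w) ->
      (forall r v, L (r *: v) = r * L v) -> (forall v, `|L v| <= `|v|) ->
      `|L (g s - g t)| <= B * `|s - t|.
    move=> LB LZ Ln; apply: (functional_lipschitz (M := 1) LB LZ gder _ _ aj jb sk tk).
      by move=> v; rewrite mul1r.
    move=> r /andP[kr rk]; apply: le_trans (Ln _) _.
    by have /andP[] : b0 <= `|dg r| <= B by apply: bB; apply/andP; split; lra.
  by apply: norm_pair_le; apply: lip => //; [exact: norm_fst_le|exact: norm_snd_le].
- move=> k s t kn sk tk; have [aj jb] := alb k kn.
  apply: (functional_lipschitz (L := fun v => cross v (udir (an k))) (M := 2)
    _ _ gder _ _ aj jb sk tk).
  + by move=> v w; exact: crossBl.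
  + by move=> r v; exact: crossZl.
  + by move=> v; exact: cross_le.
  + move=> r rk; apply: le_trans (crossdg _ _ kn rk) _.
    by rewrite ler_wpM2l// ltW.
- rewrite (eq_bigr (fun=> rho)); last by move=> k _; rewrite /be addrC addKr.
  by rewrite sumr_const card_ord -[_ *+ n]mulr_natl nrho.
- move=> t /andP[ta tb].
  have tI : 0 <= (t - a) / rho <= n%:R.
    by rewrite divr_ge0 ?subr_ge0 ?(ltW rho0)//= ler_pdivrMr// nrho lerD2r.
  have [j jn /andP[j1 j2]] := grid_index (ltn0Sn _) tI.
  rewrite ler_pdivlMr// in j1; rewrite ler_pdivrMr// mulrDl mul1r in j2.
  have jt : al j <= t <= be j by rewrite /be /al; apply/andP; split; lra.
  exists j => //; split=> // r c r0 E.
  have := crossdg j t jn jt; rewrite E crossZl cross_udir normrM -opprB sinN normrN.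
  have : b0 <= `|r|.
    have /bB/andP[+ _] : a <= t <= b by rewrite ta.
    by rewrite E => /le_trans; apply; exact: norm_Zudir.
  by have := normr_ge0 (sin (c - an j)); nra.
Qed.

Lemma curves_arcs (n : nat) (a_ b_ : nat -> R) (g_ dg_ : nat -> R -> R * R) :
  (forall i, C1_param (a_ i) (b_ i) (g_ i) (dg_ i)) ->
  exists B W : R, [/\ 0 < B, 0 <= W & forall h, 0 < h -> exists m gam al be an,
    [/\ straight_arcs m gam al be an B h, \sum_(k < m) (be k - al k) <= W
      & forall i, (i < n)%N -> cut_into m gam al be an h (a_ i) (b_ i) (g_ i) (dg_ i)]].
Proof.
move=> C1; elim: n => [|n [B [W [B0 W0 IH]]]].
  exists 1, 0; split=> // h h0; exists 0%N, (fun _ _ => 0), (fun=> 0), (fun=> 0), (fun=> 0).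
  by split=> //; rewrite big_ord0.
have [B' B'0 H] := curve_arcs (C1 n).
have ab : a_ n < b_ n by have [] := C1 n.
exists (B + B'), (W + (b_ n - a_ n)); split.
- by rewrite addr_gt0.
- by rewrite addr_ge0// subr_ge0 ltW.
move=> h h0.
have [m1 [gam1 [al1 [be1 [an1 [[P1 P2 P3] S1 C_1]]]]]] := IH h h0.
have [m2 [gam2 [al2 [be2 [an2 [[Q1 Q2 Q3] S2 C2]]]]]] := H h h0.
pose glue T (f1 f2 : nat -> T) (k : nat) := if (k < m1)%N then f1 k else f2 (k - m1)%N.
have gl1 T (f1 f2 : nat -> T) k : (k < m1)%N -> glue T f1 f2 k = f1 k.
  by rewrite /glue => ->.
have gl2 T (f1 f2 : nat -> T) k : glue T f1 f2 (m1 + k)%N = f2 k.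
  by rewrite /glue ltnNge leq_addr/= addKn.
have glP (P : nat -> Prop) : (forall k, (k < m1)%N -> P k) ->
    (forall k, (k < m2)%N -> P (m1 + k)%N) -> forall k, (k < m1 + m2)%N -> P k.
  move=> H1 H2 k; have [k1 _|k1 k2] := ltnP k m1; first exact: H1.
  by rewrite -(subnKC k1); apply: H2; rewrite ltn_subLR.
have hB1 x : h * B * `|x| <= h * (B + B') * `|x|.
  by rewrite ler_wpM2r// ler_wpM2l ?ltW// ltrDl.
have hB2 x : h * B' * `|x| <= h * (B + B') * `|x|.
  by rewrite ler_wpM2r// ler_wpM2l ?ltW// ltrDr.
exists (m1 + m2)%N, (glue _ gam1 gam2), (glue _ al1 al2), (glue _ be1 be2), (glue _ an1 an2).
split; first split.
- by apply: glP => k km; [rewrite !gl1//; exact: P1|rewrite !gl2; exact: Q1].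
- move=> k s t; move: k; apply: glP => k km; [rewrite !gl1//|rewrite !gl2] => sk tk.
    by apply: le_trans (P2 _ _ _ km sk tk) _; rewrite ler_wpM2r// lerDl ltW.
  by apply: le_trans (Q2 _ _ _ km sk tk) _; rewrite ler_wpM2r// lerDr ltW.
- move=> k s t; move: k; apply: glP => k km; [rewrite !gl1//|rewrite !gl2] => sk tk.
    exact: le_trans (P3 _ _ _ km sk tk) _.
  exact: le_trans (Q3 _ _ _ km sk tk) _.
- rewrite big_split_ord/= lerD//.
    by rewrite (eq_bigr (fun k : 'I_m1 => be1 k - al1 k))// => k _; rewrite !gl1.
  by rewrite (eq_bigr (fun k : 'I_m2 => be2 k - al2 k))// => k _; rewrite !gl2.
- move=> i; rewrite ltnS leq_eqVlt => /predU1P[->|iN] t tab.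
    have [k km [tk gk sk]] := C2 t tab; exists (m1 + k)%N; first by rewrite ltn_add2l.
    by rewrite !gl2.
  have [k km [tk gk sk]] := C_1 i iN t tab; exists k; first by rewrite ltn_addr.
  by rewrite !gl1.
Qed.

(** One stage of the construction. The enlargement [rho] of the path is built into
the covering, so that it remains valid for all later paths. *)
Lemma stage (n : nat) (a_ b_ : nat -> R) (g_ dg_ : nat -> R -> R * R)
    (f : R -> R * R) (del eps eta : R) :
  (forall i, C1_param (a_ i) (b_ i) (g_ i) (dg_ i)) ->
  continuous f -> 0 < del -> 0 < eps -> 0 < eta -> eta <= 1 ->
  exists (f' : R -> R * R) (V : set (R * R)) (rho : R),
  [/\ continuous f', forall s : R, 0 <= s <= 1 -> `|f' s - f s| <= del,
      0 < rho, covered_area V eps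
    & forall s : R, 0 <= s <= 1 -> exists2 phi : R, 0 <= phi <= pi &
      forall i t r c z, (i < n)%N -> a_ i <= t <= b_ i -> r != 0 ->
        dg_ i t = r *: udir c -> 2 * eta < `|sin (c - phi)| ->
        `|z - f' s| <= rho -> V (z + g_ i t)].
Proof.
move=> C1 fc del0 eps0 eta0 eta1.
have [B [W [B0 W0 arcs]]] := curves_arcs n C1.
have pi2 := pi_ge2 R.
have del20 : 0 < del / 20 by rewrite divr_gt0.
have f01 : {within `[0, 1], continuous f} by exact: continuous_subspaceT.
have [d d0 dP] := within_uniform f01 del20.
pose N := (Num.truncn (d^-1)).+1.
have N0 : (0 < N)%N by [].
have Nd : N%:R^-1 < d.
  by rewrite -[ltRHS]invrK ltf_pV2 ?posrE ?invr_gt0 ?ltr0n// truncnS_gt.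
have fN (s t : R) : 0 <= s <= 1 -> 0 <= t <= 1 -> `|s - t| <= N%:R^-1 ->
    `|f s - f t| <= del / 20.
  by move=> s01 t01 st; apply/ltW/dP => //; exact: le_lt_trans Nd.
pose D := (sin (eta / 2) * sin (eta / 4))^-1.
have D0 : 0 < D by exact: length_const_gt0.
pose C : R := 720.
have C720 : 720 <= C by [].
have C0 : 0 < C by rewrite ltr0n.
clearbody C.
pose Q := N%:R * (2 * del + 2) * (C * D * (B * W)).
have Q0 : 0 <= Q.
  rewrite /Q; apply: mulr_ge0; first by rewrite mulr_ge0// addr_ge0// mulr_ge0// ltW.
  by apply: mulr_ge0; [apply: mulr_ge0; exact: ltW|apply: mulr_ge0 => //; exact: ltW].
pose hm := Num.min (eta / 3) (eps / (2 * (Q + 1))).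
have Q1 : 0 < 2 * (Q + 1) by rewrite mulr_gt0// ltr_wpDl.
have hm0 : 0 < hm by rewrite lt_min !divr_gt0.
have hm1 : hm <= eta / 3 by rewrite /hm ge_min lexx.
have hm2 : hm <= eps / (2 * (Q + 1)) by rewrite /hm ge_min lexx orbT.
pose M := (Num.truncn ((pi - eta) / hm)).+1.
have M0 : 0 < M%:R :> R by rewrite ltr0n.
pose h := (pi - eta) / M%:R.
have pe0 : 0 < pi - eta by lra.
have h0 : 0 < h by rewrite divr_gt0.
have hhm : h <= hm.
  by rewrite /h ler_pdivrMr// mulrC -ler_pdivrMr// ltW// truncnS_gt.
have Mh : M%:R * h = pi - eta by rewrite /h mulrC divfK// gt_eqF.
have h3 : 3 * h <= 1 by lra.
have heta : h <= eta / 2 by lra.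
have [m [gam [al [be [an [[albe gamL gamX] sW cut]]]]]] := arcs h h0.
have [g [V [gc gf cV gV]]] :=
  tp_follow C720 albe B0 h0 h3 eta0 eta1 heta gamL gamX Mh del0 N0 fN.
have wt : \sum_(k < m) unkilled_weight al be B set0 k <= B * W.
  rewrite (eq_bigr (fun k : 'I_m => B * (be k - al k))); last first.
    by move=> k _; rewrite /unkilled_weight asboolF.
  by rewrite -mulr_sumr ler_wpM2l// ltW.
have cV' : covered_area V (eps / 2).
  apply: cov_sub cV => //; rewrite -/D.
  apply: (@le_trans _ _ (h * Q)).
    rewrite /Q [leRHS](_ : _ = N%:R * (2 * del + 2) * (C * h * D * (B * W))); last by ring.
    apply: ler_wpM2l; first by rewrite mulr_ge0// addr_ge0// mulr_ge0// ltW.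
    apply: ler_wpM2l => //; apply: mulr_ge0; last exact: ltW.
    by apply: mulr_ge0; exact: ltW.
  have : h * (2 * (Q + 1)) <= eps by rewrite -ler_pdivlMr// (le_trans hhm).
  by lra.
have eps2 : eps / 2 < eps by lra.
have [rho rho0 cVf] := cov_fat cV' eps2.
exists g, [set z | exists2 y, V y & `|z - y| <= rho], rho; split=> //.
move=> s s01; have [phi phiP] := gV s s01.
have [k /andP[k0 kpi]] := modpi_ex phi.
exists (phi + k%:~R * pi); first by rewrite k0 ltW.
move=> i t r c z iN tab r0 E sc zs.
have [j jm [tj gj sj]] := cut i iN t tab.
exists (g s + g_ i t); last by rewrite (_ : _ - _ = z - g s)//; vec_ring.
rewrite -gj; apply: phiP => //.
have e1 : `|sin (c - phi)| = `|sin (c - (phi + k%:~R * pi))|.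
  rewrite -[RHS](sinD_intpi _ k); congr (`|sin _|); ring.
have := sinD_norm_le (c - an j) (an j - phi).
have := sj r c r0 E.
rewrite (_ : c - an j + (an j - phi) = c - phi); last by ring.
by rewrite e1; lra.
Qed.

End Pieces.

(** * The limit path *)

Section LimitPath.
Context {R : realType}.

Lemma nested_limit (u rho : nat -> R) : (forall k, 0 <= rho k) ->
  (forall k j, `|u (k + j)%N - u k| <= rho k) ->
  exists L, forall k, `|L - u k| <= rho k.
Proof.
move=> rho0 H.
have below k l : u k - rho k <= u l + rho l.
  have [kl|/ltnW lk] := leqP k l.
    have := H k (l - k)%N; rewrite subnKC// ler_norml => /andP[? _].
    by have := rho0 l; lra.
  have := H l (k - l)%N; rewrite subnKC// ler_norml => /andP[_ ?].
  by have := rho0 k; lra.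
pose S := [set u k - rho k | k in [set: nat]].
have S0 : S !=set0 by exists (u 0%N - rho 0%N), 0%N.
exists (sup S) => k; rewrite ler_norml; apply/andP; split.
  have : u k - rho k <= sup S.
    apply: ub_le_sup; last by exists k.
    by exists (u 0%N + rho 0%N) => _ [l _ <-].
  by lra.
have : sup S <= u k + rho k by apply: ge_sup => // _ [l _ <-].
by lra.
Qed.

Lemma cluster_segment (u : nat -> R) (a b : R) : (forall k, a <= u k <= b) ->
  exists x : R, forall (K : nat) (e : R), 0 < e ->
    exists2 k, (K <= k)%N & `|u k - x| < e.
Proof.
move=> uab; have := @segment_compact R a b.
move=> /(_ (u @ \oo) _)[].
  by exists 0%N => // k _; rewrite /= in_itv/= uab.
move=> x [_ cx]; exists x => K e e0.
have [_ [[k Kk <-] kx]] := cx [set y | exists2 k, (K <= k)%N & u k = y] (ball x e)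
  (ex_intro2 _ _ K I (fun k Kk => ex_intro2 _ _ k Kk erefl)) (nbhsx_ballx x e e0).
by exists k => //; rewrite distrC.
Qed.

Context (a_ b_ : nat -> R) (g_ dg_ : nat -> R -> R * R).
Hypothesis C1 : forall i, C1_param (a_ i) (b_ i) (g_ i) (dg_ i).

(** The tags of a point need not converge from one stage to the next, but a cluster
point [psi] of them is enough: a tangent direction different from [psi] is far
from the tags of infinitely many stages. *)
Lemma limit_path (f0 : R -> R * R) (d0 : R) : continuous f0 -> 0 < d0 ->
  exists (g : R -> R * R) (V : nat -> set (R * R)),
  [/\ {within `[0, 1], continuous g},
      forall s : R, 0 <= s <= 1 -> `|g s - f0 s| <= d0,
      forall k, covered_area (V k) (2^-1 ^+ k)
    & forall s : R, 0 <= s <= 1 -> exists psi : R,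
      forall i t r c, a_ i <= t <= b_ i -> r != 0 ->
        dg_ i t = r *: udir c -> sin (c - psi) != 0 ->
        forall K : nat, exists2 k, (K <= k)%N & V k (g s + g_ i t)].
Proof.
move=> cf0 d00.
pose eta (k : nat) : R := (k.+1%:R)^-1.
have /choice[F FP] (x : nat * ((R -> R * R) * R)) :
    exists y : ((R -> R * R) * R) * set (R * R),
    continuous x.2.1 -> 0 < x.2.2 ->
    [/\ continuous y.1.1 /\ 0 < y.1.2,
        y.1.2 <= x.2.2 / 2,
        forall s : R, 0 <= s <= 1 -> `|y.1.1 s - x.2.1 s| <= x.2.2 / 2,
        covered_area y.2 (2^-1 ^+ x.1)
      & forall s : R, 0 <= s <= 1 -> exists2 phi : R, 0 <= phi <= pi &
      forall i t r c z, (i < x.1)%N -> a_ i <= t <= b_ i -> r != 0 ->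
        dg_ i t = r *: udir c -> 2 * eta x.1 < `|sin (c - phi)| ->
        `|z - y.1.1 s| <= y.1.2 -> y.2 (z + g_ i t)].
  case: x => k [f rho] /=.
  have [[cf rho0]|nf] := pselect (continuous f /\ 0 < rho); last first.
    by exists ((f0, d0), set0) => cf rho0; exfalso; apply: nf.
  have rho20 : 0 < rho / 2 by rewrite divr_gt0.
  have eps0 : 0 < 2^-1 ^+ k :> R by rewrite exprn_gt0// invr_gt0.
  have eta0 : 0 < eta k by rewrite invr_gt0 ltr0n.
  have eta1 : eta k <= 1 by rewrite invf_le1 ?ltr0n// ler1n.
  have [f' [V [rho' [cf' ff' rho'0 cV sV]]]] := stage k C1 cf rho20 eps0 eta0 eta1.
  exists ((f', Num.min rho' (rho / 2)), V) => _ _ /=; split=> //.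
  - by rewrite lt_min rho'0.
  - by rewrite ge_min lexx orbT.
  - move=> s /sV[phi phi01 phiP]; exists phi => // i t r c z iN tab r0 E sc zs.
    by apply: phiP E sc _ => //; apply: le_trans zs _; rewrite ge_min lexx.
pose st := fix st k := if k is j.+1 then (F (j, st j)).1 else (f0, d0).
pose f k := (st k).1; pose rho k := (st k).2; pose V k := (F (k, st k)).2.
have cont k : continuous (f k) /\ 0 < rho k.
  by elim: k => [|k [ck rk]]; [split|have [] := FP (k, st k) ck rk].
have fc k := (cont k).1; have rho0 k := (cont k).2.
have step k : [/\ rho k.+1 <= rho k / 2,
    forall s : R, 0 <= s <= 1 -> `|f k.+1 s - f k s| <= rho k / 2,
    covered_area (V k) (2^-1 ^+ k) & forall s : R, 0 <= s <= 1 -> exists2 phi : R, 0 <= phi <= pi &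
      forall i t r c z, (i < k)%N -> a_ i <= t <= b_ i -> r != 0 ->
        dg_ i t = r *: udir c -> 2 * eta k < `|sin (c - phi)| ->
        `|z - f k.+1 s| <= rho k.+1 -> V k (z + g_ i t)].
  by have [] := FP (k, st k) (fc k) (rho0 k).
have far (s : R) (k j : nat) : 0 <= s <= 1 -> `|f (k + j)%N s - f k s| <= rho k.
  move=> s01; elim: j k => [|j IH] k; first by rewrite addn0 subrr normr0 ltW.
  have [r1 /(_ s s01) r2 _ _] := step k.
  have := IH k.+1; rewrite addSnnS => r3.
  rewrite -(subrKA (f k.+1 s)); apply: le_trans (ler_normD _ _) _.
  by lra.
have rhoE k : rho k <= d0 * 2^-1 ^+ k.
  elim: k => [|k IH]; first by rewrite expr0 mulr1.
  by have [r1 _ _ _] := step k; rewrite exprSr mulrA; lra.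
have rho_small (e : R) : 0 < e -> exists k, rho k < e.
  move=> e0; exists (Num.truncn (d0 / e)).+1; set n := _.+1.
  apply: le_lt_trans (rhoE n) _; rewrite exprVn ltr_pdivrMr ?exprn_gt0//.
  rewrite mulrC -ltr_pdivrMr//.
  apply: lt_trans (truncnS_gt _) _.
  by rewrite -natrX ltr_nat ltn_expl.
have lim s : exists L : R * R, 0 <= s <= 1 -> forall k, `|L - f k s| <= rho k.
  have [s01|] := boolP (0 <= s <= 1); last by exists 0.
  have [L1 H1] := @nested_limit (fun k => (f k s).1) rho (fun k => ltW (rho0 k))
    (fun k j => le_trans (norm_fst_le (f (k + j)%N s - f k s)) (far s k j s01)).
  have [L2 H2] := @nested_limit (fun k => (f k s).2) rho (fun k => ltW (rho0 k))
    (fun k j => le_trans (norm_snd_le (f (k + j)%N s - f k s)) (far s k j s01)).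
  by exists (L1, L2) => _ k; apply: norm_pair_le; [exact: H1|exact: H2].
have [g gP] := choice lim.
exists g, V; split.
- apply/within_continuousP => x e x01 e0.
  have e30 : 0 < e / 3 by rewrite divr_gt0.
  have [k rk] := rho_small _ e30.
  have fk01 : {within `[0, 1], continuous (f k)} by exact: continuous_subspaceT.
  have [d dp dP] := (within_continuousP _ _ _).1 fk01 x (e / 3) x01 e30.
  exists d => // y y01 xy.
  have h1 := gP x x01 k; have h2 := gP y y01 k; have h3 := dP y y01 xy.
  have -> : g x - g y = (g x - f k x) + (f k x - f k y) - (g y - f k y) by vec_ring.
  apply: le_lt_trans (ler_normB _ _) _.
  have := ler_normD (g x - f k x) (f k x - f k y).
  by lra.
- by move=> s s01; exact: gP s s01 0%N.
- by move=> k; have [] := step k.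
- move=> s s01.
  have tags k : exists phi : R, 0 <= phi <= pi /\
      forall i t r c z, (i < k)%N -> a_ i <= t <= b_ i -> r != 0 ->
        dg_ i t = r *: udir c -> 2 * eta k < `|sin (c - phi)| ->
        `|z - f k.+1 s| <= rho k.+1 -> V k (z + g_ i t).
    by have [_ _ _ /(_ s s01)[phi p1 p2]] := step k; exists phi.
  have [phi /all_and2[phi01 phiP]] := choice tags.
  have [psi psiP] := cluster_segment phi01.
  exists psi => i t r c tab r0 E sc K.
  have sg0 : 0 < `|sin (c - psi)| by rewrite normr_gt0.
  set sg := `|_| in sg0.
  have sg20 : 0 < sg / 2 by rewrite divr_gt0.
  pose K' := maxn K (maxn i.+1 (Num.truncn (4 / sg))).
  have [k K'k kpsi] := psiP K' _ sg20.
  move: K'k; rewrite !geq_max => /andP[Kk /andP[ik tk]].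
  exists k => //; apply: (phiP k i t r c) => //; last exact: gP.
  have etak : 2 * eta k < sg / 2.
    have : 4 / sg < k.+1%:R.
      by apply: lt_le_trans (truncnS_gt _) _; rewrite ler_nat.
    rewrite ltr_pdivrMr// => h4.
    have e1 : eta k * k.+1%:R = 1 by rewrite /eta mulVf// pnatr_eq0.
    have e2 : 0 < eta k by rewrite /eta invr_gt0 ltr0n.
    by nra.
  have := sinD_norm_le (c - phi k) (phi k - psi).
  have := sin_norm_le (phi k - psi).
  rewrite (_ : c - phi k + (phi k - psi) = c - psi); last by ring.
  by rewrite -/sg; lra.
Qed.

End LimitPath.

(** * Two paths across a rectangle meet *)

Section Crossing.

(** A grid point has label 2 if its first boolean [a] holds; otherwise its label is
1 or 0 according to the second boolean [b]. These are the edges between the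
labels 0 and 1. *)
Definition bichromatic (a b a' b' : bool) : bool := [&& ~~ a, ~~ a' & b (+) b'].

(** Sperner's lemma on a square grid. In a cell that misses a label, the number of
bichromatic sides is even; without a cell that has all the labels, the parity of
the number of bichromatic horizontal edges is therefore the same on each row, but
it is even on the bottom row and odd on the top row. *)
Lemma sperner_square (N : nat) (lo le : nat -> nat -> bool) :
  (0 < N)%N -> (forall i, lo i 0%N) -> (forall j, le 0%N j) -> (forall j, ~~ le N j) ->
  (forall i, ~~ lo i N) ->
  exists i j, (i < N)%N /\ (j < N)%N /\
    let corner (P : nat -> nat -> Prop) := exists k l, [/\ (k <= 1)%N, (l <= 1)%N & P (i + k)%N (j + l)%N] in
    [/\ corner (fun k l => lo k l), corner (fun k l => ~~ lo k l /\ le k l)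
      & corner (fun k l => ~~ lo k l /\ ~~ le k l)].
Proof.
move=> N0 bot left right top.
pose hor i j := bichromatic (lo i j) (le i j) (lo i.+1 j) (le i.+1 j).
pose ver i j := bichromatic (lo i j) (le i j) (lo i j.+1) (le i j.+1).
pose par n j := \big[addb/false]_(i < n) hor i j.
have parS n j : par n.+1 j = par n j (+) hor n j by rewrite /par big_ord_recr.
apply: contrapT => nocell.
have cell i j : (i < N)%N -> (j < N)%N -> hor i j (+) hor i j.+1 = ver i j (+) ver i.+1 j.
  move=> iN jN; apply/eqP; apply: contra_notT nocell => ne; exists i, j; split=> //; split=> //=.
  have corners (P : nat -> nat -> Prop) :
      [\/ P i j, P i.+1 j, P i j.+1 | P i.+1 j.+1] ->
      exists k l, [/\ (k <= 1)%N, (l <= 1)%N & P (i + k)%N (j + l)%N].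
    by case=> ?; [exists 0%N, 0%N|exists 1%N, 0%N|exists 0%N, 1%N|exists 1%N, 1%N];
      rewrite ?addn0 ?addn1.
  move: ne; rewrite /hor /ver /bichromatic => ne.
  split; [apply: (corners (fun k l => lo k l))
         |apply: (corners (fun k l => ~~ lo k l /\ le k l))
         |apply: (corners (fun k l => ~~ lo k l /\ ~~ le k l))]; move: ne => /=;
  case: (lo i j) (le i j) (lo i.+1 j) (le i.+1 j) (lo i j.+1) (le i j.+1) (lo i.+1 j.+1) (le i.+1 j.+1)
    => [] [] [] [] [] [] [] [] //= _;
  by [constructor 1|constructor 2|constructor 3|constructor 4].
have rows j n : (j < N)%N -> (n <= N)%N -> par n j (+) par n j.+1 = ver n j.
  move=> jN; elim: n => [|n IH] nN.
    by rewrite /par !big_ord0 /ver /bichromatic !left !andbF.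
  rewrite !parS addbACA IH ?(ltnW nN)// cell// addbA addbb.
  by [].
have rowN j : (j < N)%N -> par N j.+1 = par N j.
  move=> jN; have := rows j N jN (leqnn N).
  rewrite /ver /bichromatic !(negbTE (right _)) !andbF.
  by case: (par N j) (par N j.+1) => [] [].
have bottom : par N 0%N = false.
  by rewrite /par big1// => i _; rewrite /hor /bichromatic !bot.
have topP n : par n N = ~~ le n N.
  elim: n => [|n IH]; first by rewrite /par big_ord0 left.
  rewrite parS IH /hor /bichromatic !top/=.
  by case: (le n N) (le n.+1 N) => [] [].
have : par N N = false.
  suff H j : (j <= N)%N -> par N j = false by exact: H.
  by elim: j => // j IH jN; rewrite rowN// IH// ltnW.
by rewrite topP right.
Qed.

Context {R : realType}.

Lemma continuous_clamped (p : R -> R * R) : {within `[0, 1], continuous p} ->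
  continuous (p \o clamp01).
Proof.
have c01 (x : R) : 0 <= clamp01 x <= 1.
  have [x0|x0] := leP x 0; first by rewrite clamp01_le0// lexx ler01.
  have [x1|x1] := leP 1 x; first by rewrite clamp01_ge1// lexx ler01.
  by rewrite clamp01_id ?ltW// !ltW.
move=> /within_continuousP cp x; apply/cvgrPdist_lt => e e0 /=.
have [d d0 dP] := cp _ e (c01 x) e0.
have /cvgrPdist_lt/(_ d d0) := @continuous_clamp01 R x.
by apply: filterS => y; exact: dP (c01 y).
Qed.

(** The theorem of Poincare and Miranda for the map (s, t) |-> p s + q t, whose zeros
are the common points of [q] and the reflected path - p. Sperner's lemma on finer
and finer grids gives approximate zeros, and compactness a zero. *)
Lemma paths_cross (p q : R -> R * R) :
  {within `[0, 1], continuous p} -> {within `[0, 1], continuous q} ->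
  (forall t : R, 0 <= t <= 1 -> (p 0 + q t).1 < 0 /\ 0 < (p 1 + q t).1) ->
  (forall s : R, 0 <= s <= 1 -> (p s + q 0).2 < 0 /\ 0 < (p s + q 1).2) ->
  exists s t : R, [/\ 0 <= s <= 1, 0 <= t <= 1 & p s + q t = 0].
Proof.
move=> cp cq leri boto.
have approx (e : R) : 0 < e -> exists s t : R,
    [/\ 0 <= s <= 1, 0 <= t <= 1 & `|p s + q t| <= e].
  move=> e0; have e20 : 0 < e / 2 by rewrite divr_gt0.
  have [d1 d10 d1P] := within_uniform cp e20.
  have [d2 d20 d2P] := within_uniform cq e20.
  pose d := Num.min d1 d2.
  have d0 : 0 < d by rewrite lt_min d10.
  pose N := (Num.truncn d^-1).+1.
  have N0 : 0 < N%:R :> R by rewrite ltr0n.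
  have Nd : N%:R^-1 < d.
    by rewrite -[ltRHS]invrK ltf_pV2 ?posrE ?invr_gt0 ?ltr0n// truncnS_gt.
  pose x (i : nat) : R := Num.min 1 (i%:R / N%:R).
  have x01 i : 0 <= x i <= 1.
    by rewrite /x le_min ler01/= ge_min lexx divr_ge0.
  have x0 : x 0%N = 0 by rewrite /x mul0r min_r.
  have xN : x N = 1 by rewrite /x divff ?gt_eqF// minxx.
  have xI i : (i <= N)%N -> x i = i%:R / N%:R.
    by move=> iN; rewrite /x min_r// ler_pdivrMr// mul1r ler_nat.
  have xd i k : (i < N)%N -> (k <= 1)%N -> `|x i - x (i + k)%N| < d.
    move=> iN k1; rewrite !xI ?(ltnW iN)//; last first.
      by rewrite (leq_trans _ iN)// -addn1 leq_add2l.
    rewrite -mulrBl natrD opprD addNKr normrM normrN normfV (gtr0_norm N0).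
    apply: le_lt_trans Nd; rewrite ger0_norm//.
    by rewrite ler_piMl ?invr_ge0 ?(ltW N0)// (ler_nat _ k 1).
  pose G i j := p (x i) + q (x j).
  (* A point of the cell given by Sperner's lemma has both coordinates close to 0,
     as each of them takes both signs in the cell. *)
  have [] := @sperner_square N (fun i j => (G i j).2 < 0) (fun i j => (G i j).1 < 0).
  - by [].
  - by move=> i; rewrite /G x0; have [] := boto _ (x01 i).
  - by move=> j; rewrite /G x0; have [] := leri _ (x01 j).
  - by move=> j; rewrite -leNgt /G xN; have [_ /ltW] := leri _ (x01 j).
  - by move=> i; rewrite -leNgt /G xN; have [_ /ltW] := boto _ (x01 i).
  move=> i [j [iN [jN /= [c2 c1 c0]]]].
  have near k l : (k <= 1)%N -> (l <= 1)%N -> `|G i j - G (i + k)%N (j + l)%N| <= e.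
    move=> k1 l1; rewrite /G.
    have -> : p (x i) + q (x j) - (p (x (i + k)%N) + q (x (j + l)%N)) =
      (p (x i) - p (x (i + k)%N)) + (q (x j) - q (x (j + l)%N)) by vec_ring.
    apply: le_trans (ler_normD _ _) _.
    have hd k' i' : (i' < N)%N -> (k' <= 1)%N ->
        `|x i' - x (i' + k')%N| < d1 /\ `|x i' - x (i' + k')%N| < d2.
      by move=> a b; have := xd i' k' a b; rewrite lt_min => /andP.
    have := d1P _ _ (x01 i) (x01 _) (hd k i iN k1).1.
    have := d2P _ _ (x01 j) (x01 _) (hd l j jN l1).2.
    by lra.
  have near1 k l k1 l1 := le_trans (norm_fst_le (_ : R * R)) (near k l k1 l1).
  have near2 k l k1 l1 := le_trans (norm_snd_le (_ : R * R)) (near k l k1 l1).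
  exists (x i), (x j); split=> //; rewrite -/(G i j).
  case: c2 => k2 [l2 [k21 l21 h2]].
  case: c1 => k1 [l1 [k11 l11 [h1 f1]]].
  case: c0 => k0 [l0 [k01 l01 [h0 f0]]].
  have := near1 _ _ k11 l11; have := near1 _ _ k01 l01.
  have := near2 _ _ k21 l21; have := near2 _ _ k01 l01.
  rewrite -!leNgt in h0 f0; rewrite /= !ler_norml.
  move=> /andP[? ?] /andP[? ?] /andP[? ?] /andP[? ?].
  rewrite /G/= in h1 f1 h2 h0 f0 *.
  by apply: norm_pair_le; rewrite /= ler_norml; apply/andP; split; lra.
pose F (x : R * R) : R := `|(p \o clamp01) x.1 + (q \o clamp01) x.2|.
have cF : continuous F.
  move=> x; apply: cvg_norm; apply: cvgD.
    apply: (@cvg_comp _ _ _ fst (p \o clamp01) (nbhs x) (nbhs x.1)); first exact: cvg_fst.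
    exact: continuous_clamped.
  apply: (@cvg_comp _ _ _ snd (q \o clamp01) (nbhs x) (nbhs x.2)); first exact: cvg_snd.
  exact: continuous_clamped.
have K : compact (`[0, 1] `*` `[0, 1] : set (R * R)).
  by apply: compact_setX; exact: segment_compact.
have K0 : (`[0, 1] `*` `[0, 1] : set (R * R)) !=set0.
  by exists (0, 0); split; rewrite /= in_itv/= lexx ler01.
have [[s t] /[1!inE] -[/=]] := compact_EVT_min K0 K (continuous_subspaceT cF).
rewrite !in_itv/= => s01 t01 Fmin.
exists s, t; split=> //; apply/normr0_eq0/eqP; rewrite -[_ == 0]negbK; apply/negP.
rewrite -normr_gt0 normr_id => pos.
have pos2 : 0 < `|p s + q t| / 2 by rewrite divr_gt0.
have [s' [t' [s'01 t'01 small]]] := approx _ pos2.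
have := Fmin (s', t'); rewrite inE /F/= !clamp01_id// => /(_ _)H.
have {}H := H (conj _ _).
suff : `|p s + q t| <= `|p s' + q t'| by lra.
by apply: H; rewrite in_itv.
Qed.

End Crossing.

(** * Null sets *)

Section NullSets.
Context {R : realType}.
Implicit Types S : set (R * R).

Lemma diam_ge0 S : (0 <= diam S)%E.
Proof. by apply: ereal_sup_ubound; left. Qed.

Lemma H1_nullP S : H1_null S <-> forall d e : R, 0 < d -> 0 < e ->
  exists U : nat -> set (R * R), [/\ S `<=` \bigcup_i U i,
    forall i, (diam (U i) <= d%:E)%E & (\sum_(0 <= i <oo) diam (U i) <= e%:E)%E].
Proof.
split=> [S0 d e d0 e0|H].
  have : (hausdorff1_pre d S < e%:E)%E.
    apply: (@le_lt_trans _ _ 0%E); last by rewrite lte_fin.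
    by rewrite -S0; apply: ereal_sup_ubound; exists d.
  move=> /ereal_inf_lt[_ [U [SU Ud] <-] Ue].
  by exists U; split=> //; exact: ltW.
apply/eqP; rewrite eq_le; apply/andP; split.
  apply: ge_ereal_sup => _ [d d0 <-]; apply/lee_addgt0Pr => e e0.
  have [U [SU Ud Ue]] := H d e d0 e0.
  rewrite add0e; apply: le_trans Ue; apply: ereal_inf_lbound.
  by exists U.
apply: (@le_trans _ _ (hausdorff1_pre 1 S)).
  apply: le_ereal_inf_tmp => _ [U _ <-]; apply: nneseries_ge0 => i _ _; exact: diam_ge0.
by apply: ereal_sup_ubound; exists 1 => //=.
Qed.

Lemma H1_null_sub S S' : S `<=` S' -> H1_null S' -> H1_null S.
Proof.
move=> SS' /H1_nullP H; apply/H1_nullP => d e d0 e0.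
by have [U [SU Ud Ue]] := H d e d0 e0; exists U; split=> // x /SS'/SU.
Qed.

Lemma H1_null_bigcup (S : nat -> set (R * R)) :
  (forall k, H1_null (S k)) -> H1_null (\bigcup_k S k).
Proof.
move=> S0; apply/H1_nullP => d e d0 e0.
have /choice[U UP] k : exists U : nat -> set (R * R), [/\ S k `<=` \bigcup_i U i,
    forall i, (diam (U i) <= d%:E)%E & (\sum_(0 <= i <oo) diam (U i) <= (e / (2 ^ k.+1)%:R)%:E)%E].
  by have /H1_nullP := S0 k; apply => //; rewrite divr_gt0// ltr0n expn_gt0.
(* The countable coverings are merged along a bijection from nat to pairs. *)
have /pcard_eqP[p] := card_esym card_nat2.
exists (fun n => U (p n).1 (p n).2); split.
- move=> x [k _ Skx]; have [/(_ x Skx)[i _ Ux] _ _] := UP k.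
  have [n _ pn] := @surj _ _ _ _ p (k, i) I.
  by exists n => //; rewrite pn.
- by move=> n; have [_ + _] := UP (p n).1; exact.
- rewrite nneseries_esumT; last by move=> n; exact: diam_ge0.
  rewrite -(@reindex_esum R _ _ [set: nat] [set: nat * nat] p (fun x => diam (U x.1 x.2))); last first.
    by split; [exact: funS|exact: inj|exact: surj].
  have -> : [set: nat * nat] = [set: nat] `*`` (fun=> [set: nat]).
    by apply/seteqP; split.
  rewrite -(@esum_esum R _ _ [set: nat] (fun=> [set: nat]) (fun k i => diam (U k i))); last first.
    by move=> *; exact: diam_ge0.
  apply: le_trans (epsilon_trick0 xpredT (ltW e0)).
  rewrite [leRHS]nneseries_esumT; last first.
    by move=> n; rewrite lee_fin divr_ge0// ltW.
  apply: le_esum => k _; rewrite -nneseries_esumT; last by move=> n; exact: diam_ge0.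
  by have [] := UP k.
Qed.

Lemma H1_nullU S S' : H1_null S -> H1_null S' -> H1_null (S `|` S').
Proof.
move=> S0 S'0.
apply: (@H1_null_sub _ (\bigcup_k (if k is 0%N then S else S'))).
  by move=> x [?|?]; [exists 0%N|exists 1%N].
by apply: H1_null_bigcup => -[].
Qed.

Local Notation leb2 := (@lebesgue_measure R \x @lebesgue_measure R)%E.

Lemma cov_measurable (V : set (R * R)) (e : R) : covered_area V e ->
  exists W : set (R * R), [/\ measurable W, V `<=` W & (leb2 W <= (4 * e)%:E)%E].
Proof.
move=> [s [sV s0 se]].
suff [W [mW sW We]] : exists W : set (R * R), [/\ measurable W,
    forall c z, c \in s -> `|z - c.1| <= c.2 -> W z
    & (leb2 W <= (4 * \sum_(c <- s) c.2 ^+ 2)%:E)%E].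
  exists W; split=> //; first by move=> z /sV[c cs cz]; exact: sW cs cz.
  by apply: le_trans We _; rewrite lee_fin ler_pM2l.
elim: s s0 {sV se} => [|c s IH] s0.
  by exists set0; split=> //; rewrite measure0 big_nil mulr0.
have [|W [mW sW We]] := IH; first by move=> c' c's; apply: s0; rewrite inE c's orbT.
have c20 : 0 <= c.2 by apply: s0; rewrite inE eqxx.
pose Q : set (R * R) := `[c.1.1 - c.2, c.1.1 + c.2] `*` `[c.1.2 - c.2, c.1.2 + c.2].
have side (x : R) : @lebesgue_measure R `[x - c.2, x + c.2]%classic = (2 * c.2)%:E.
  rewrite lebesgue_measure_itv/= lte_fin.
  case: ltP => h; first by rewrite -EFinD; congr (_%:E); ring.
  by congr (_%:E); lra.
have mQ : measurable Q by apply: measurableX; exact: measurable_itv.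
have QE : leb2 Q = (4 * c.2 ^+ 2)%:E.
  rewrite /Q product_measure1E; [|exact: measurable_itv|exact: measurable_itv].
  by rewrite [X in (X * _)%E]side [X in (_ * X)%E]side -EFinM; congr (_%:E); ring.
exists (Q `|` W); split.
- exact: measurableU.
- move=> c' z; rewrite inE => /predU1P[->|c's] cz; last by right; exact: sW c's cz.
  have := le_trans (norm_fst_le _) cz; have := le_trans (norm_snd_le _) cz.
  rewrite /= !ler_norml => /andP[? ?] /andP[? ?].
  by left; split; rewrite /= in_itv/=; apply/andP; split; lra.
- apply: (@le_trans _ _ (leb2 Q + leb2 W)%E); first exact: measureU2.
  by rewrite big_cons mulrDr EFinD leeD// -QE.
Qed.

Lemma null_limsup (V : nat -> set (R * R)) (A : set (R * R)) :
  (forall k, covered_area (V k) (2^-1 ^+ k)) ->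
  (forall z, A z -> forall K, exists2 k, (K <= k)%N & V k z) ->
  lebesgue_null2 A.
Proof.
move=> cV AV.
have /choice[W WP] k := cov_measurable (cV k).
exists (lim_sup_set W); split.
- apply: bigcapT_measurable => n; apply: bigcup_measurable => k _.
  by have [] := WP k.
- apply: lim_sup_set_cvg0; first by move=> k; have [] := WP k.
  apply: (@le_lt_trans _ _ 8%:E); last exact: ltry.
  apply: le_trans (epsilon_trick0 xpredT (ler0n _ 8)).
  apply: lee_nneseries => k _ //; have [_ _] := WP k.
  move=> /le_trans; apply; rewrite lee_fin natrX exprS exprVn.
  by rewrite le_eqVlt; apply/orP; left; apply/eqP; field; rewrite expf_neq0.
- move=> z /AV H n _; have [k nk Vz] := H n; exists k => //.
  by have [_ + _] := WP k; exact.
Qed.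

Lemma null_bigcup_rat (F : rat * rat -> set (R * R)) :
  (forall q, lebesgue_null2 (F q)) -> lebesgue_null2 (\bigcup_q F q).
Proof.
move=> F0.
have : lebesgue_null2 (\bigcup_n (if unpickle n is Some q then F q else set0)).
  apply: negligible_bigcup => n; case: unpickle => [q|]; first exact: F0.
  exact: negligible_set0.
apply: (@negligibleS _ _ _ leb2) => z [q _ Fz]; exists (pickle q); first exact: I.
rewrite pickleK; exact: Fz.
Qed.

End NullSets.

(** * The sum of a curve and a nearly straight path has interior points *)

Section ThickSum.
Context {R : realType}.

Lemma reparam (gam : R -> R * R) (a b t0 t1 : R) : {within `[a, b], continuous gam} ->
  a <= t0 <= b -> a <= t1 <= b ->
  {within `[0, 1], continuous (fun t => gam (t0 + (t1 - t0) * t))} /\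
  forall t : R, 0 <= t <= 1 -> a <= t0 + (t1 - t0) * t <= b.
Proof.
move=> /within_continuousP cg /andP[at0 t0b] /andP[at1 t1b].
have inab t : 0 <= t <= 1 -> a <= t0 + (t1 - t0) * t <= b.
  by move=> /andP[? ?]; apply/andP; split; nra.
split=> //; apply/within_continuousP => x e x01 e0.
have [d d0 dP] := cg _ e (inab x x01) e0.
have K0 : 0 < `|t1 - t0| + 1 by rewrite ltr_wpDl.
exists (d / (`|t1 - t0| + 1)); first by rewrite divr_gt0.
move=> y y01; rewrite ltr_pdivlMr// => xy.
apply: dP; first exact: inab.
rewrite (_ : _ - _ = (t1 - t0) * (x - y)); last by ring.
by rewrite normrM; have := normr_ge0 (x - y); lra.
Qed.

Lemma path_bounded (q : R -> R * R) : {within `[0, 1], continuous q} ->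
  exists M : R, forall t : R, 0 <= t <= 1 -> `|q t| <= M.
Proof.
move=> /within_continuousP cq.
have nc : {within `[0, 1], continuous (fun t => `|q t|)}.
  apply/within_continuousP => x e x01 e0.
  have [d d0 dP] := cq x e x01 e0; exists d => // y y01 xy.
  by apply: le_lt_trans (ler_dist_dist _ _) _; exact: dP.
have [c _ H] := EVT_max (@ler01 R) nc.
by exists `|q c| => t t01; apply: H; rewrite in_itv.
Qed.

Lemma within_shift (g : R -> R * R) (z : R * R) : {within `[0, 1], continuous g} ->
  {within `[0, 1], continuous (fun s => g s - z)}.
Proof.
move=> /within_continuousP cg; apply/within_continuousP => x e x01 e0.
have [d d0 dP] := cg x e x01 e0; exists d => // y y01 xy.
by rewrite (_ : _ - _ = g x - g y); [exact: dP|vec_ring].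
Qed.

(** The path runs along a horizontal segment that is longer than [q] is wide, and the
climb of [q] exceeds the height of the band that contains the reflected path
z - g. *)
Lemma thick_sum_vert (q : R -> R * R) : {within `[0, 1], continuous q} ->
  (q 0).2 < (q 1).2 ->
  exists (f : R -> R * R) (d r : R) (c : R * R), [/\ continuous f, 0 < d, 0 < r
  & forall g : R -> R * R, {within `[0, 1], continuous g} ->
    (forall s : R, 0 <= s <= 1 -> `|g s - f s| <= d) ->
    forall z, `|z - c| <= r -> exists s t : R,
      [/\ 0 <= s <= 1, 0 <= t <= 1 & g s + q t = z]].
Proof.
move=> cq q01; have [M qM] := path_bounded cq.
pose e := ((q 1).2 - (q 0).2) / 4.
have e0 : 0 < e by rewrite divr_gt0// subr_gt0.
have e4 : (q 1).2 - (q 0).2 = 4 * e by rewrite /e; field.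
(* M bounds the norm of q; the rest of L accounts for the closeness
   e / 2 and for the position of z. *)
pose L := M + 2 * e + 1; have LE : L = M + 2 * e + 1 by [].
pose f (s : R) : R * R := (- L, 0) + s *: (2 * L, 0).
exists f, (e / 2), e, (0, (q 0).2 + 2 * e); split=> //.
- move=> s; apply: cvgD; first exact: cvg_cst.
  exact: scalel_continuous.
- by rewrite divr_gt0.
move=> g cg gf z zc.
have i0 : 0 <= (0 : R) <= 1 by rewrite lexx ler01.
have i1 : 0 <= (1 : R) <= 1 by rewrite lexx ler01.
have z1 := le_trans (norm_fst_le _) zc; have z2 := le_trans (norm_snd_le _) zc.
move: z1 z2; rewrite /= !ler_norml => /andP[? ?] /andP[? ?].
have gf1 s s01 := le_trans (norm_fst_le _) (gf s s01).
have gf2 s s01 := le_trans (norm_snd_le _) (gf s s01).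
have [] := @paths_cross R (fun s => g s - z) q (within_shift (z := z) cg) cq.
- move=> t t01; have := le_trans (norm_fst_le _) (qM t t01).
  have := gf1 0 i0; have := gf1 1 i1.
  rewrite /f /GRing.scale/= /GRing.scale/= !ler_norml.
  move=> /andP[? ?] /andP[? ?] /andP[? ?].
  by split; lra.
- move=> s s01; have := gf2 s s01.
  rewrite /f /GRing.scale/= /GRing.scale/= !ler_norml => /andP[? ?].
  by split; lra.
move=> s [t [s01 t01 E]]; exists s, t; split=> //.
by apply/eqP; rewrite -subr_eq0; apply/eqP; rewrite -E; vec_ring.
Qed.

(** Here [q] crosses from left to right, and the path climbs. *)
Lemma thick_sum_horiz (q : R -> R * R) : {within `[0, 1], continuous q} ->
  (q 0).1 < (q 1).1 ->
  exists (f : R -> R * R) (d r : R) (c : R * R), [/\ continuous f, 0 < d, 0 < r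
  & forall g : R -> R * R, {within `[0, 1], continuous g} ->
    (forall s : R, 0 <= s <= 1 -> `|g s - f s| <= d) ->
    forall z, `|z - c| <= r -> exists s t : R,
      [/\ 0 <= s <= 1, 0 <= t <= 1 & g s + q t = z]].
Proof.
move=> cq q01; have [M qM] := path_bounded cq.
pose e := ((q 1).1 - (q 0).1) / 4.
have e0 : 0 < e by rewrite divr_gt0// subr_gt0.
have e4 : (q 1).1 - (q 0).1 = 4 * e by rewrite /e; field.
pose L := M + 2 * e + 1; have LE : L = M + 2 * e + 1 by [].
pose f (s : R) : R * R := (0, - L) + s *: (0, 2 * L).
exists f, (e / 2), e, ((q 0).1 + 2 * e, 0); split=> //.
- move=> s; apply: cvgD; first exact: cvg_cst.
  exact: scalel_continuous.
- by rewrite divr_gt0.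
move=> g cg gf z zc.
have i0 : 0 <= (0 : R) <= 1 by rewrite lexx ler01.
have i1 : 0 <= (1 : R) <= 1 by rewrite lexx ler01.
have z1 := le_trans (norm_fst_le _) zc; have z2 := le_trans (norm_snd_le _) zc.
move: z1 z2; rewrite /= !ler_norml => /andP[? ?] /andP[? ?].
have gf1 s s01 := le_trans (norm_fst_le _) (gf s s01).
have gf2 s s01 := le_trans (norm_snd_le _) (gf s s01).
have [] := @paths_cross R q (fun s => g s - z) cq (within_shift (z := z) cg).
- move=> s s01; have := gf1 s s01.
  rewrite /f /GRing.scale/= /GRing.scale/= !ler_norml => /andP[? ?].
  by split; lra.
- move=> t t01; have := le_trans (norm_snd_le _) (qM t t01).
  have := gf2 0 i0; have := gf2 1 i1.
  rewrite /f /GRing.scale/= /GRing.scale/= !ler_norml.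
  move=> /andP[? ?] /andP[? ?] /andP[? ?].
  by split; lra.
move=> t [s [t01 s01 E]]; exists s, t; split=> //.
by apply/eqP; rewrite -subr_eq0; apply/eqP; rewrite -E; vec_ring.
Qed.

Lemma thick_sum (Gamma : set (R * R)) (a b : R) (gam : R -> R * R) (x y : R * R) :
  {within `[a, b], continuous gam} -> Gamma = gam @` `[a, b] ->
  Gamma x -> Gamma y -> x <> y ->
  exists (f : R -> R * R) (d r : R) (c : R * R), [/\ continuous f, 0 < d, 0 < r
  & forall g : R -> R * R, {within `[0, 1], continuous g} ->
    (forall s : R, 0 <= s <= 1 -> `|g s - f s| <= d) ->
    forall z, `|z - c| <= r -> exists s w,
      [/\ 0 <= s <= 1, Gamma w & g s + w = z]].
Proof.
move=> cg -> [t0 + <-] [t1 + <-] xy; rewrite /= !in_itv/= => t0ab t1ab.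
suff [u [v [uab vab H]]] : exists u v, [/\ a <= u <= b, a <= v <= b &
    (gam u).2 < (gam v).2 \/ (gam u).1 < (gam v).1].
  have [cq qab] := reparam cg uab vab.
  pose q (t : R) := gam (u + (v - u) * t).
  change {within `[0, 1], continuous q} in cq.
  have E0 : q 0 = gam u by rewrite /q mulr0 addr0.
  have E1 : q 1 = gam v by rewrite /q mulr1 addrC subrK.
  suff [f [d [r [c [cf d0 r0 P]]]]] : exists (f : R -> R * R) (d r : R) (c : R * R),
      [/\ continuous f, 0 < d, 0 < r
      & forall g : R -> R * R, {within `[0, 1], continuous g} ->
      (forall s : R, 0 <= s <= 1 -> `|g s - f s| <= d) ->
      forall z, `|z - c| <= r -> exists s t : R,
      [/\ 0 <= s <= 1, 0 <= t <= 1 & g s + q t = z]].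
    exists f, d, r, c; split=> // g cg' gf z zc.
    have [s [t [s01 t01 E]]] := P g cg' gf z zc.
    by exists s, (q t); split=> //; exists (u + (v - u) * t); rewrite //= in_itv qab.
  case: H => H; [apply: thick_sum_vert|apply: thick_sum_horiz] => //;
    by rewrite E0 E1.
(* The two end points are ordered so that q climbs or else runs to the right. *)
have [lt|lt|e2] := ltgtP (gam t0).2 (gam t1).2.
- by exists t0, t1; split=> //; left.
- by exists t1, t0; split=> //; left.
have [lt|lt|e1] := ltgtP (gam t0).1 (gam t1).1.
- by exists t0, t1; split=> //; right.
- by exists t1, t0; split=> //; right.
by exfalso; apply: xy; exact: pair_ext.
Qed.

End ThickSum.

(** * The theorem *)
Lemma dir_eq (R : realType) (a b : R) : sin (a - b) = 0 -> dir a = dir b.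
Proof.
move=> /sin_eq0_intpi[k E]; apply/eqmodP/asboolP.
by exists k.
Qed.

Lemma ratvec_dense (R : realType) (v : R * R) (r : R) : 0 < r ->
  exists q, `|v - ratvec R q| <= r.
Proof.
move=> r0.
have near (x : R) : exists q : rat, `|x - ratr q| <= r.
  have [|q] := @rat_in_itvoo R (x - r) (x + r); first by lra.
  rewrite in_itv/= => /andP[? ?]; exists q.
  by rewrite ler_norml; apply/andP; split; lra.
have [q1 H1] := near v.1; have [q2 H2] := near v.2.
by exists (q1, q2); apply: norm_pair_le.
Qed.

Theorem theorem6p10 (R : realType) (E Gamma : set (R * R))
    (theta : R * R -> P1 R)
    (hE : rectifiable E) (htheta : tangent_field E theta)
    (hGamma : rectifiable_curve Gamma)
    (hnull : forall d : P1 R, H1_null [set x | E x /\ theta x = d]) :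
  exists (E0 P : set (R * R)) (phi : R * R -> P1 R),
    [/\ full_H1 E0 E, is_path P &
      let Ep (p : R * R) := [set x | E0 x /\ theta x <> phi p] in
      let A := \bigcup_(q in [set: rat * rat]) \bigcup_(p in P)
                 [set ratvec R q + p + x | x in Ep p] in
      lebesgue_null2 A /\
      forall y : R * R, exists (Ey : set (R * R)) (py : R * R),
        [/\ Ey `<=` E, H1_null (E `\` Ey),
            [set py + z | z in Gamma] y
          & [set py + x | x in Ey] `<=` A]].
Proof.
have [G [GC GE]] := hE.
have /choice[cv cvP] i : exists c : (R * R) * ((R -> R * R) * (R -> R * R)),
    C1_param c.1.1 c.1.2 c.2.1 c.2.2 /\ G i = c.2.1 @` `[c.1.1, c.1.2].
  by have [a [b [g [dg H]]]] := GC i; exists ((a, b), (g, dg)).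
pose a_ i := (cv i).1.1; pose b_ i := (cv i).1.2.
pose g_ i := (cv i).2.1; pose dg_ i := (cv i).2.2.
have C1 i : C1_param (a_ i) (b_ i) (g_ i) (dg_ i) := (cvP i).1.
have GE' i : G i = g_ i @` `[a_ i, b_ i] := (cvP i).2.
have [[a [b [gam [ab cgam _ GammaE]]]] [x [y [Gx Gy xy]]]] := hGamma.
have [f0 [d0 [r [c [cf0 d00 r0 thick]]]]] := thick_sum cgam GammaE Gx Gy xy.
have [g [V [cg gf cV gV]]] := limit_path C1 cf0 d00.
pose P := g @` `[0, 1].
pose E0 := [set x | [/\ E x, exists i, G i x &
  forall i, G i x -> forall d, tangent_direction (a_ i) (b_ i) (g_ i) (dg_ i) x d ->
    d = theta x]].
have /choice[phi phiP] p : exists d : P1 R, P p -> exists2 psi, d = dir psi &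
    forall i t r c, a_ i <= t <= b_ i -> r != 0 ->
      dg_ i t = r *: udir c -> sin (c - psi) != 0 ->
      forall K : nat, exists2 k, (K <= k)%N & V k (p + g_ i t).
  have [[s + <-]|nP] := pselect (P p); last by exists (dir 0).
  rewrite /= in_itv/= => /gV[psi psiP].
  by exists (dir psi) => _; exists psi.
have E0full : H1_null (E `\` E0).
  apply: (@H1_null_sub _ _ ((E `\` \bigcup_i G i) `|` \bigcup_i
     [set x | (g_ i @` `[a_ i, b_ i] `&` E) x /\
      ~ (forall d, tangent_direction (a_ i) (b_ i) (g_ i) (dg_ i) x d -> d = theta x)])).
    move=> z [Ez nE0]; have [Gz|nG] := pselect (exists i, G i z); last first.
      by left; split=> // -[i _ Gi]; apply: nG; exists i.
    right; apply: contrapT => nU; apply: nE0; split=> // i Giz d dz.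
    apply: contrapT => ne; apply: nU; exists i => //; split.
      by split=> //; rewrite -GE'.
    by move=> H; apply: ne; exact: H.
  apply: H1_nullU => //; apply: H1_null_bigcup => i.
  exact: htheta.
exists E0, P, phi; split.
- by split=> // z [].
- by exists 0, 1, g; split.
move=> Ep A; split.
  apply: (@negligibleS _ _ _ (@lebesgue_measure R \x @lebesgue_measure R)%E
    (\bigcup_q [set z | forall K : nat, exists2 k, (K <= k)%N & V k (z - ratvec R q)])).
    move=> _ [q _ [p Pp [z [[Ez [i Giz] tz] nz] <-]]]; exists q => // K.
    have [psi dpsi psiP] := phiP p Pp.
    have := Giz; rewrite GE' => -[t + gt]; rewrite /= in_itv/= => tab.
    have dg0 : dg_ i t != 0 by have [_ _ _ ->] := C1 i; rewrite ?in_itv.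
    have [al [rr [rr0 dgE]]] := polar_ex dg0.
    have dal : dir al = theta z.
      apply: (tz i Giz); exists t; first by rewrite /= in_itv.
      by split=> //; exists al, rr; split=> //; rewrite dgE.
    have sn : sin (al - psi) != 0.
      by apply/eqP => /dir_eq H; apply: nz; rewrite -dal H.
    have [k Kk Vk] := psiP i t rr al tab rr0 dgE sn K.
    exists k => //; rewrite (_ : _ - _ = p + g_ i t)// gt; vec_ring.
  apply: null_bigcup_rat => q.
  apply: (@null_limsup _ (fun k => [set z | V k (z - ratvec R q)])) => [k|z]; last by apply.
  exact: cov_translate.
move=> z; have [q qz] := ratvec_dense (z - c) r0.
have [] := thick g cg gf (z - ratvec R q).
  by rewrite (_ : _ - _ = z - c - ratvec R q)//; vec_ring.
move=> s [w [s01 Gw gw]].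
have Ps : P (g s) by exists s; rewrite //= in_itv.
exists (Ep (g s)), (ratvec R q + g s); split.
- by move=> u [[]].
- apply: (@H1_null_sub _ _ ((E `\` E0) `|` [set x | E x /\ theta x = phi (g s)])).
    move=> u [Eu nEp]; have [E0u|nE0u] := pselect (E0 u); last by left.
    by right; split=> //; apply: contrapT => ne; apply: nEp.
  by apply: H1_nullU => //; exact: hnull.
- by exists w => //; rewrite -addrA gw addrC subrK.
- by move=> _ [u Eu <-]; exists q => //; exists (g s) => //; exists u.
Qed.
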